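(* Let $K$ be an infinite proper subset of $\mathbb{Z}_+$ such that $H^{\infty}_K(\mathbb{D})$ is an algebra and $$\mathbb{Z}_+ \setminus K = \{ n_1d, n_2d, \dots , n_pd, N_0d, (N_0 + j)d : j \in \mathbb{Z}_+ \}$$ for some positive integer $d$, some finite set $\{n_i\}_{i=1}^p \subset \mathbb{Z}_+$ where $n_1 < n_2 < \cdots < n_p$, and a positive integer $N_0 > n_p$. Moreover, let $K_1 \subset \mathbb{Z}_+$ be such that $$\mathbb{Z}_+\setminus K_1 = \{n_1,n_2,\dotsc,n_p, N_0, N_0 + j : j \in \mathbb{Z}_+\}.$$ Let $z_1, z_2, \dotsc,z_n$ be distinct points in $\mathbb{D}$ and $w_1, w_2, \dotsc, w_n$ be points in $\mathbb{D}$. If there exists an $f \in H^{\infty}_K(\mathbb{D})$ with $f(z_i) = w_i$ for $i = 1,2,\dotsc,n$ and $\|f\|_{\infty} \leq 1$, then there is a $\lambda \in \mathbb{D}$ such that the $n\times n$ matrix $$\left[\frac{z_i^{n_1d}\, \overline{z_j^{n_1d}} - \varphi_{\lambda}(w_i)\, \overline{\varphi_{\lambda}(w_j)}}{1-z_i^{d}\,\overline{z_j^{d}}}\right]_{i,j=1}^n$$ is positive semidefinite, where $n_1$ is the smallest positive integer not in $K_1$.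
   Context: $\mathbb{D}$ is the open unit disk in $\mathbb{C}$ and $\mathbb{Z}_+$ is the set of positive integers. $H^{\infty}(\mathbb{D})$ is the set of bounded analytic functions on $\mathbb{D}$, with $\|f\|_\infty = \sup\{|f(z)| : z\in\mathbb{D}\}$. For a nonempty set $K\subset\mathbb{Z}_+$, $H^{\infty}_K(\mathbb{D}) = \{f\in H^{\infty}(\mathbb{D}) : f^{(k)}(0)=0 \text{ for all } k\in K\}$. Saying that $H^{\infty}_K(\mathbb{D})$ is an algebra means that it is an algebra under pointwise operations, i.e. it is closed under pointwise multiplication (which does not hold for every $K$). For $\lambda\in\mathbb{D}$, $\varphi_{\lambda}(z) = \frac{z-\lambda}{1-\overline{\lambda}z}$. *)

(* Defs.v *)
From Stdlib Require Export Reals Ensembles Finite_sets.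
From Coquelicot Require Export Coquelicot.

Open Scope C_scope.

Definition pos_nat : Ensemble nat := fun k => (0 < k)%nat.

Definition disk (z : C) : Prop := (Cmod z < 1)%R.

(* Functions on the disk are total functions [C -> C] of which only the values
   on [disk] matter: the function spaces below depend on those values alone. *)

Definition analytic (f : C -> C) : Prop :=
  forall z : C, disk z -> @ex_derive C_AbsRing C_NormedModule f z.

Definition bounded_on_disk (f : C -> C) : Prop :=
  exists M : R, forall z : C, disk z -> (Cmod (f z) <= M)%R.

Definition Hinf (f : C -> C) : Prop := analytic f /\ bounded_on_disk f.

(* A supremum in the extended reals, so that it is meaningful for every [f]. *)
Definition Hinf_norm (f : C -> C) : Rbar :=
  Lub_Rbar (fun r : R => exists z : C, disk z /\ r = Cmod (f z)).

(* [C_derive] is total; it is the complex derivative wherever the latter exists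
   ([C_derive_correct]). *)
Fixpoint C_derive_n (f : C -> C) (k : nat) : C -> C :=
  match k with
  | O => f
  | S k' => C_derive (C_derive_n f k')
  end.

Definition HinfK (K : Ensemble nat) (f : C -> C) : Prop :=
  Hinf f /\ forall k : nat, In nat K k -> C_derive_n f k 0 = 0.

Definition is_algebra (A : (C -> C) -> Prop) : Prop :=
  (forall f g : C -> C, A f -> A g -> A (fun z => f z + g z)) /\
  (forall (c : C) (f : C -> C), A f -> A (fun z => c * f z)) /\
  (forall f g : C -> C, A f -> A g -> A (fun z => f z * g z)).

Definition mobius (lambda z : C) : C :=
  (z - lambda) / (1 - Cconj lambda * z).

(* The quadratic form is real and nonnegative on all complex vectors, which over
   the complex numbers forces the matrix to be Hermitian.  [sum_n a m] has
   [m + 1] terms; for [n = 0] the single term is the default coefficient [0]. *)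
Definition positive_semidefinite {n : nat} (A : @matrix C n n) : Prop :=
  forall v : nat -> C,
    let q : C :=
      sum_n (fun i => sum_n (fun j =>
        Cconj (v i) * coeff_mat (RtoC 0) A i j * v j) (pred n)) (pred n) in
    Im q = 0%R /\ (0 <= Re q)%R.

Definition is_least (E : Ensemble nat) (m : nat) : Prop :=
  In nat E m /\ forall k : nat, In nat E k -> (m <= k)%nat.

(* Main.v *)
Require Import Defs.
From Stdlib Require Import Lra Lia Psatz Classical IndefiniteDescription.

(* The derivatives of f that vanish at 0 leave only exponents in d N, and none strictly between
   0 and n_1 d, so f(z) = g(z^d) with g(s) = lambda + s^(n_1) h(s) and lambda = f(0).  Hence
   mobius lambda (g s) = s^(n_1) G(s) for the analytic function
   G = h / (1 - conj lambda g), and the matrix of the theorem is the Pick matrix of G at the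
   points z_i^d, conjugated by a diagonal matrix.  That Pick matrix is positive because, with
   Szego kernels k_i on the circle |s| = r, u = sum c_i k_i and
   v = sum c_i conj (G (x_i)) k_i, the Cauchy formula gives <G v, u> = <v, v>; expanding
   |G v - B^2 u|^2 with |G| <= B = r^(-n_1) on the circle yields <v, v> <= B^2 <u, u>, and
   r tends to 1.

   The Cauchy formula for functions that are merely complex differentiable comes from
   Goursat's bisection argument in the logarithmic coordinates z = exp (s + i t), where it
   says that circle means do not depend on the radius. *)

(** * Complex continuity and differentiability *)

(** Analyticity here is bare complex differentiability: the partial derivatives are not known to be
    continuous, so Green's theorem in its usual form is out of reach, which is why a bisection
    argument comes first. On a circle dz = i z dt, so the mean of F is 1 / (2 pi i) times the
    contour integral of F(z) dz / z. Working with means removes every factor 2 pi i and turns the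
    Cauchy kernel into z / (z - z0). The bound |f| <= 1 only places lambda = f(0) in the closed
    disk. Openness is a maximum principle; it is obtained from the Pick inequality itself, the
    interior value w_1 excluding |f(0)| = 1. For d > 1 the map z -> z^d has no analytic inverse near
    0, so g is built from Taylor coefficients. Its bound |g| <= 1 then comes from d-th roots, which
    need only exist pointwise. The constant B = r^(-n_1) is what |s^(n_1) G(s)| = |mobius lambda (g
    s)| <= 1 says about |G| on |s| = r. *)

Definition ccont (f : C -> C) (z : C) : Prop :=
  forall eps : R, (0 < eps)%R -> exists delta : R, (0 < delta)%R /\
    forall w : C, (Cmod (w - z) < delta)%R -> (Cmod (f w - f z) < eps)%R.

(** The non-strict bound includes [w = z] and is, up to commutativity, what the library's domination
    condition unfolds to, so [is_derive_cderiv] needs no estimate. *)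
Definition cderiv (f : C -> C) (z l : C) : Prop :=
  forall eps : R, (0 < eps)%R -> exists delta : R, (0 < delta)%R /\
    forall w : C, (Cmod (w - z) < delta)%R ->
      (Cmod (f w - f z - l * (w - z)) <= eps * Cmod (w - z))%R.

Definition holo (f : C -> C) (z : C) : Prop := exists l : C, cderiv f z l.

Lemma Cmod_sub_comm (x y : C) : Cmod (x - y) = Cmod (y - x).
Proof. rewrite <- Cmod_opp. f_equal. ring. Qed.

Lemma Cmod_triangle_rev (x y : C) : (Cmod x - Cmod y <= Cmod (x - y))%R.
Proof.
  pose proof (Cmod_triangle (x - y) y) as H.
  replace (x - y + y) with x in H by ring. lra.
Qed.

Lemma Cmod_pos (x : C) : x <> 0 -> (0 < Cmod x)%R.
Proof. apply Cmod_gt_0. Qed.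

Lemma neq0_of_Cmod (x : C) : (0 < Cmod x)%R -> x <> 0.
Proof. apply Cmod_gt_0. Qed.

(* Goals about [sum_n] are stated in an unfolded carrier type that [ring] does not recognize. *)
Ltac cring := intros; match goal with |- @eq _ ?a ?b => change (@eq C a b) end; ring.

Lemma Csum_scal (c : C) (a : nat -> C) (n : nat) :
  sum_n (fun k => c * a k) n = c * sum_n a n.
Proof.
  induction n as [|n IH]; [now rewrite !sum_O|].
  rewrite !sum_Sn, IH. change plus with Cplus. cring.
Qed.

Lemma Csum_minus (a b : nat -> C) (n : nat) :
  sum_n (fun k => a k - b k) n = sum_n a n - sum_n b n.
Proof.
  induction n as [|n IH]; [now rewrite !sum_O|].
  rewrite !sum_Sn, IH. change plus with Cplus. cring.
Qed.

Lemma ccont_const (c z : C) : ccont (fun _ => c) z.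
Proof.
  intros eps He. exists 1%R. split; [lra|]. intros w _.
  replace (c - c) with (RtoC 0) by ring. rewrite Cmod_0. exact He.
Qed.

Lemma ccont_id (z : C) : ccont (fun w => w) z.
Proof. intros eps He. exists eps. split; [exact He|]. intros w Hw. exact Hw. Qed.

Lemma ccont_ext_loc (f g : C -> C) (z : C) (d : R) :
  (0 < d)%R -> (forall w, (Cmod (w - z) < d)%R -> f w = g w) ->
  ccont f z -> ccont g z.
Proof.
  intros Hd E Hf eps He. destruct (Hf eps He) as [del [Hdel H]].
  exists (Rmin d del). split; [now apply Rmin_glb_lt|]. intros w Hw.
  rewrite <- E by (eapply Rlt_le_trans; [exact Hw|apply Rmin_l]).
  rewrite <- E.
  - apply H. eapply Rlt_le_trans; [exact Hw|apply Rmin_r].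
  - replace (z - z) with (RtoC 0) by ring. rewrite Cmod_0. exact Hd.
Qed.

Lemma ccont_conj (f : C -> C) (z : C) : ccont f z -> ccont (fun w => Cconj (f w)) z.
Proof.
  intros Hf eps He. destruct (Hf eps He) as [d [Hd H]]. exists d. split; [exact Hd|].
  intros w Hw. rewrite <- Cminus_conj, Cmod_conj. now apply H.
Qed.

Lemma ccont_plus (f g : C -> C) (z : C) :
  ccont f z -> ccont g z -> ccont (fun w => f w + g w) z.
Proof.
  intros Hf Hg eps He.
  destruct (Hf (eps / 2)%R) as [d1 [Hd1 H1]]; [lra|].
  destruct (Hg (eps / 2)%R) as [d2 [Hd2 H2]]; [lra|].
  exists (Rmin d1 d2). split; [now apply Rmin_glb_lt|]. intros w Hw.
  assert (Hw1 := H1 w (Rlt_le_trans _ _ _ Hw (Rmin_l _ _))).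
  assert (Hw2 := H2 w (Rlt_le_trans _ _ _ Hw (Rmin_r _ _))).
  replace (f w + g w - (f z + g z)) with ((f w - f z) + (g w - g z)) by ring.
  pose proof (Cmod_triangle (f w - f z) (g w - g z)). lra.
Qed.

Lemma ccont_mult (f g : C -> C) (z : C) :
  ccont f z -> ccont g z -> ccont (fun w => f w * g w) z.
Proof.
  intros Hf Hg eps He.
  (* When both increments are below [e <= 1], the error is at most
     [e * (Cmod (f z) + Cmod (g z) + 1)]; the [2] in [A] leaves one spare [e], which makes the final
     inequality strict. *)
  set (A := (Cmod (f z) + Cmod (g z) + 2)%R).
  assert (HA : (2 <= A)%R).
  { unfold A. pose proof (Cmod_ge_0 (f z)); pose proof (Cmod_ge_0 (g z)); lra. }
  set (e := Rmin 1 (eps / A)).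
  assert (He' : (0 < e)%R).
  { apply Rmin_glb_lt; [lra|]. apply Rdiv_lt_0_compat; lra. }
  destruct (Hf e He') as [d1 [Hd1 H1]].
  destruct (Hg e He') as [d2 [Hd2 H2]].
  exists (Rmin d1 d2). split; [now apply Rmin_glb_lt|]. intros w Hw.
  assert (Hw1 := H1 w (Rlt_le_trans _ _ _ Hw (Rmin_l _ _))).
  assert (Hw2 := H2 w (Rlt_le_trans _ _ _ Hw (Rmin_r _ _))).
  replace (f w * g w - f z * g z)
    with ((f w - f z) * (g w - g z) + (f z * (g w - g z) + g z * (f w - f z))) by ring.
  assert (e1 : (e <= 1)%R) by apply Rmin_l.
  assert (e2 : (e * A <= eps)%R).
  { apply Rmult_le_reg_r with (/ A)%R; [apply Rinv_0_lt_compat; lra|].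
    rewrite Rmult_assoc, Rinv_r, Rmult_1_r by lra. apply Rmin_r. }
  pose proof (Cmod_triangle ((f w - f z) * (g w - g z))
    (f z * (g w - g z) + g z * (f w - f z))) as T1.
  pose proof (Cmod_triangle (f z * (g w - g z)) (g z * (f w - f z))) as T2.
  rewrite Cmod_mult in T1. rewrite (Cmod_mult (f z)), (Cmod_mult (g z)) in T2.
  pose proof (Cmod_ge_0 (f z)); pose proof (Cmod_ge_0 (g z)).
  pose proof (Cmod_ge_0 (f w - f z)); pose proof (Cmod_ge_0 (g w - g z)).
  assert (Cmod (f w - f z) * Cmod (g w - g z) <= 1 * e)%R
    by (apply Rmult_le_compat; lra).
  assert (Cmod (f z) * Cmod (g w - g z) <= Cmod (f z) * e)%R
    by (apply Rmult_le_compat_l; lra).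
  assert (Cmod (g z) * Cmod (f w - f z) <= Cmod (g z) * e)%R
    by (apply Rmult_le_compat_l; lra).
  unfold A in e2. clearbody e. rewrite !Rmult_plus_distr_l in e2. lra.
Qed.

Lemma ccont_inv (f : C -> C) (z : C) :
  f z <> 0 -> ccont f z -> ccont (fun w => / f w) z.
Proof.
  intros Hz Hf eps He.
  pose proof (Cmod_pos _ Hz) as P. set (m := Cmod (f z)) in *.
  (* The first bound keeps [Cmod (f w)] above [m / 2], so the denominator [f w * f z] exceeds
     [m * m / 2] in modulus; the second makes the numerator smaller than [eps] times that. *)
  destruct (Hf (Rmin (m / 2) (eps * (m * m / 2))))%R as [d [Hd H]].
  { apply Rmin_glb_lt; [lra|]. apply Rmult_lt_0_compat; [exact He|].
    pose proof (Rmult_lt_0_compat m m P P). lra. }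
  exists d. split; [exact Hd|]. intros w Hw. specialize (H w Hw).
  assert (Ha := Rlt_le_trans _ _ _ H (Rmin_l _ _)).
  assert (Hb := Rlt_le_trans _ _ _ H (Rmin_r _ _)).
  assert (Hm : (m / 2 < Cmod (f w))%R).
  { pose proof (Cmod_triangle_rev (f z) (f w)) as T. rewrite Cmod_sub_comm in T.
    fold m in T. lra. }
  assert (Hw0 : f w <> 0) by (apply neq0_of_Cmod; lra).
  replace (/ f w - / f z) with (- (f w - f z) / (f w * f z)) by (field; auto).
  rewrite Cmod_div by (now apply Cmult_neq_0).
  rewrite Cmod_opp, Cmod_mult. fold m.
  assert (Q : (m * m / 2 < Cmod (f w) * m)%R) by nra.
  apply Rmult_lt_reg_r with (Cmod (f w) * m)%R; [nra|].
  unfold Rdiv. rewrite Rmult_assoc, Rinv_l, Rmult_1_r by nra. nra.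
Qed.

Lemma ccont_minus (f g : C -> C) (z : C) :
  ccont f z -> ccont g z -> ccont (fun w => f w - g w) z.
Proof.
  intros Hf Hg. unfold Cminus. apply ccont_plus; [exact Hf|].
  apply (ccont_ext_loc (fun w => (- (1)) * g w) _ _ 1); [lra| |].
  - intros; ring.
  - apply ccont_mult; [apply ccont_const|exact Hg].
Qed.

Lemma ccont_pow (f : C -> C) (n : nat) (z : C) : ccont f z -> ccont (fun w => f w ^ n) z.
Proof.
  intros Hf. induction n as [|n IH]; simpl; [apply ccont_const|].
  now apply ccont_mult.
Qed.

Lemma ccont_sum_n (f : nat -> C -> C) (n : nat) (z : C) :
  (forall k, (k <= n)%nat -> ccont (f k) z) -> ccont (fun w => sum_n (fun k => f k w) n) z.
Proof.
  induction n as [|n IH]; intros H.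
  - apply (ccont_ext_loc (f O) _ _ 1); [lra| |now apply H].
    intros. now rewrite sum_O.
  - apply (ccont_ext_loc (fun w => sum_n (fun k => f k w) n + f (S n) w) _ _ 1); [lra| |].
    + intros. now rewrite sum_Sn.
    + apply ccont_plus; [apply IH; intros; apply H; lia|now apply H].
Qed.

(* Caratheodory's form of differentiability: it reduces the differentiation rules
   to continuity rules. *)
Lemma holo_slope (f : C -> C) (z : C) :
  holo f z <-> exists q : C -> C, ccont q z /\ forall w, f w = f z + q w * (w - z).
Proof.
  split.
  - intros [l Hl].
    exists (fun w => match Ceq_dec w z with left _ => l
                     | right _ => (f w - f z) / (w - z) end).
    split.
    + intros eps He. destruct (Hl (eps / 2)%R) as [d [Hd H]]; [lra|].
      exists d. split; [exact Hd|]. intros w Hw.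
      destruct (Ceq_dec z z) as [_|n]; [|now destruct n].
      destruct (Ceq_dec w z) as [->|n].
      * replace (l - l) with (RtoC 0) by ring. now rewrite Cmod_0.
      * assert (Hn : w - z <> 0).
        { intros E. apply n. replace w with (w - z + z) by ring. rewrite E. ring. }
        replace ((f w - f z) / (w - z) - l)
          with ((f w - f z - l * (w - z)) / (w - z)) by (field; exact Hn).
        rewrite Cmod_div by exact Hn. specialize (H w Hw).
        pose proof (Cmod_pos _ Hn).
        apply Rmult_lt_reg_r with (Cmod (w - z)); [assumption|].
        unfold Rdiv. rewrite Rmult_assoc, Rinv_l, Rmult_1_r by lra. nra.
    + intros w. destruct (Ceq_dec w z) as [->|n]; [ring|].
      field. intros E. apply n. replace w with (w - z + z) by ring. rewrite E. ring.
  - intros [q [Hq E]]. exists (q z). intros eps He.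
    destruct (Hq eps He) as [d [Hd H]]. exists d. split; [exact Hd|]. intros w Hw.
    rewrite (E w). replace (f z + q w * (w - z) - f z - q z * (w - z))
      with ((q w - q z) * (w - z)) by ring.
    rewrite Cmod_mult. apply Rmult_le_compat_r; [apply Cmod_ge_0|].
    now apply Rlt_le, H.
Qed.

Lemma holo_ccont (f : C -> C) (z : C) : holo f z -> ccont f z.
Proof.
  intros H. apply holo_slope in H. destruct H as [q [Hq E]].
  apply (ccont_ext_loc (fun w => f z + q w * (w - z)) _ _ 1); [lra| |].
  - intros. now rewrite <- E.
  - apply ccont_plus; [apply ccont_const|]. apply ccont_mult; [exact Hq|].
    apply ccont_minus; [apply ccont_id|apply ccont_const].
Qed.

Lemma holo_ext_loc (f g : C -> C) (z : C) (d : R) :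
  (0 < d)%R -> (forall w, (Cmod (w - z) < d)%R -> f w = g w) -> holo f z -> holo g z.
Proof.
  intros Hd E [l Hl]. exists l. intros eps He. destruct (Hl eps He) as [del [Hdel H]].
  exists (Rmin d del). split; [now apply Rmin_glb_lt|]. intros w Hw.
  rewrite <- E by (eapply Rlt_le_trans; [exact Hw|apply Rmin_l]).
  rewrite <- E.
  - apply H. eapply Rlt_le_trans; [exact Hw|apply Rmin_r].
  - replace (z - z) with (RtoC 0) by ring. rewrite Cmod_0. exact Hd.
Qed.

Lemma holo_const (c z : C) : holo (fun _ => c) z.
Proof.
  apply holo_slope. exists (fun _ => 0). split; [apply ccont_const|]. intros; ring.
Qed.

Lemma holo_id (z : C) : holo (fun w => w) z.
Proof.
  apply holo_slope. exists (fun _ => 1). split; [apply ccont_const|]. intros; ring.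
Qed.

Lemma holo_plus (f g : C -> C) (z : C) :
  holo f z -> holo g z -> holo (fun w => f w + g w) z.
Proof.
  intros Hf Hg. apply holo_slope in Hf, Hg. apply holo_slope.
  destruct Hf as [p [Hp Ep]]; destruct Hg as [q [Hq Eq]].
  exists (fun w => p w + q w). split; [now apply ccont_plus|].
  intros w. rewrite (Ep w), (Eq w). ring.
Qed.

Lemma holo_mult (f g : C -> C) (z : C) :
  holo f z -> holo g z -> holo (fun w => f w * g w) z.
Proof.
  intros Hf Hg. pose proof (holo_ccont _ _ Hg) as Cg.
  apply holo_slope in Hf, Hg. apply holo_slope.
  destruct Hf as [p [Hp Ep]]; destruct Hg as [q [Hq Eq]].
  exists (fun w => p w * g w + f z * q w). split.
  - apply ccont_plus; apply ccont_mult; auto using ccont_const.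
  - intros w. rewrite (Ep w). rewrite (Eq w). ring.
Qed.

Lemma holo_inv (f : C -> C) (z : C) :
  f z <> 0 -> holo f z -> holo (fun w => / f w) z.
Proof.
  intros Hz Hf. pose proof (holo_ccont _ _ Hf) as Cf.
  destruct (Cf (Cmod (f z))) as [d [Hd H]]; [now apply Cmod_pos|].
  assert (Hn : forall w, (Cmod (w - z) < d)%R -> f w <> 0).
  { intros w Hw E. specialize (H w Hw). rewrite E in H.
    replace (0 - f z) with (- f z) in H by ring. rewrite Cmod_opp in H. lra. }
  apply holo_slope in Hf. destruct Hf as [q [Hq E]].
  (* A slope must satisfy its identity at every [w], but that of [/ f] is controlled only where [f]
     does not vanish. The function is therefore first replaced, near [z], by one for which the
     identity holds by definition. *)
  apply (holo_ext_loc (fun w => / f z + (- q w / (f w * f z)) * (w - z)) _ _ d Hd).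
  - intros w Hw. specialize (Hn w Hw).
    assert (Q : q w * (w - z) = f w - f z) by (rewrite (E w); ring).
    replace (- q w / (f w * f z) * (w - z)) with (- (q w * (w - z)) / (f w * f z))
      by (field; auto).
    rewrite Q. field; auto.
  - apply holo_slope. exists (fun w => - q w / (f w * f z)). split.
    + unfold Cdiv. apply ccont_mult.
      * apply (ccont_ext_loc (fun w => 0 - q w) _ _ 1); [lra|intros; ring|].
        apply ccont_minus; auto using ccont_const.
      * apply ccont_inv; [now apply Cmult_neq_0|].
        apply ccont_mult; auto using ccont_const.
    + intros w. ring.
Qed.

Lemma holo_minus (f g : C -> C) (z : C) :
  holo f z -> holo g z -> holo (fun w => f w - g w) z.
Proof.
  intros Hf Hg. unfold Cminus. apply holo_plus; [exact Hf|].
  apply (holo_ext_loc (fun w => (- (1)) * g w) _ _ 1); [lra| |].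
  - intros; ring.
  - apply holo_mult; [apply holo_const|exact Hg].
Qed.

Lemma holo_pow (f : C -> C) (n : nat) (z : C) : holo f z -> holo (fun w => f w ^ n) z.
Proof.
  intros Hf. induction n as [|n IH]; simpl; [apply holo_const|].
  now apply holo_mult.
Qed.

Lemma holo_sum_n (f : nat -> C -> C) (n : nat) (z : C) :
  (forall k, (k <= n)%nat -> holo (f k) z) -> holo (fun w => sum_n (fun k => f k w) n) z.
Proof.
  induction n as [|n IH]; intros H.
  - apply (holo_ext_loc (f O) _ _ 1); [lra| |now apply H].
    intros. now rewrite sum_O.
  - apply (holo_ext_loc (fun w => sum_n (fun k => f k w) n + f (S n) w) _ _ 1); [lra| |].
    + intros. now rewrite sum_Sn.
    + apply holo_plus; [apply IH; intros; apply H; lia|now apply H].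
Qed.

Lemma is_derive_cderiv (f : C -> C) (z l : C) :
  @is_derive C_AbsRing C_NormedModule f z l <-> cderiv f z l.
Proof.
  split.
  - intros [_ H] eps He.
    destruct (H z (fun P HP => HP) (mkposreal eps He)) as [d Hd].
    exists d. split; [apply cond_pos|]. intros w Hw. specialize (Hd w Hw).
    rewrite (Cmult_comm l). exact Hd.
  - intros H. split; [apply is_linear_scal_l|]. intros x Hx eps.
    (* The domination condition is asked at every limit [x] of the neighbourhood filter of [z];
       uniqueness of limits makes [x] equal to [z]. *)
    rewrite (is_filter_lim_locally_unique (V := AbsRing_NormedModule C_AbsRing) z x Hx) in *.
    destruct (H eps (cond_pos eps)) as [d [Hd H1]].
    exists (mkposreal d Hd). intros w Hw. specialize (H1 w Hw).
    rewrite (Cmult_comm l) in H1. exact H1.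
Qed.

Lemma ex_derive_holo (f : C -> C) (z : C) :
  @ex_derive C_AbsRing C_NormedModule f z -> holo f z.
Proof. intros [l Hl]. exists l. now apply is_derive_cderiv. Qed.

(** * Closed differential forms on rectangles *)

(** The counterclockwise integral of the form P dx + Q dy around the rectangle, with opposite sides
    paired under one integral sign. *)
Definition boundary_int (P Q : R -> R -> R) (a b c d : R) : R :=
  (RInt (fun x => P x c - P x d) a b + RInt (fun y => Q b y - Q a y) c d)%R.

(** Closedness is the shared [q]: the y-derivative of [P] equals the x-derivative of [Q]. Only
    differentiability at the point is asked, without continuity of the partial derivatives. *)
Definition closed_form_at (P Q : R -> R -> R) (x y : R) : Prop :=
  exists p q r : R, differentiable_pt_lim P x y p q /\ differentiable_pt_lim Q x y q r.

Lemma differentiable_pt_lim_continuous (f : R -> R -> R) (x y l1 l2 : R) :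
  differentiable_pt_lim f x y l1 l2 ->
  continuous (fun u => f u y) x /\ continuous (fun v => f x v) y.
Proof.
  intros H.
  assert (Hc : continuity_2d_pt f x y).
  { apply differentiable_continuity_pt. exists l1, l2. exact H. }
  split; apply continuity_pt_filterlim; apply continuity_pt_locally; intros eps;
    destruct (Hc eps) as [d Hd]; exists d; intros u Hu; apply Hd;
    first [exact Hu | rewrite Rminus_diag, Rabs_R0; apply cond_pos].
Qed.

Lemma ex_RInt_cont (f : R -> R) (a b : R) :
  (a <= b)%R -> (forall x, (a <= x <= b)%R -> continuous f x) -> ex_RInt f a b.
Proof.
  intros Hab H. apply (ex_RInt_continuous (V := R_CompleteNormedModule)).
  intros z. rewrite Rmin_left, Rmax_right by exact Hab. apply H.
Qed.

Section Rectangle.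

Variables P Q : R -> R -> R.
Variables a b c d : R.
Hypothesis closed : forall x y, (a <= x <= b)%R -> (c <= y <= d)%R -> closed_form_at P Q x y.

Let inside (a' b' c' d' : R) : Prop :=
  (a <= a' /\ a' <= b' /\ b' <= b /\ c <= c' /\ c' <= d' /\ d' <= d)%R.

Local Lemma ex_RInt_horizontal (a' b' y y' : R) :
  (a <= a')%R -> (a' <= b')%R -> (b' <= b)%R -> (c <= y <= d)%R -> (c <= y' <= d)%R ->
  ex_RInt (fun x => P x y - P x y')%R a' b'.
Proof.
  intros. apply ex_RInt_cont; [assumption|]. intros x Hx.
  apply (continuous_minus (V := R_NormedModule) (fun x => P x y) (fun x => P x y')).
  - destruct (closed x y) as [p [q [r [Hp _]]]]; [lra|lra|].
    apply (differentiable_pt_lim_continuous _ _ _ _ _ Hp).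
  - destruct (closed x y') as [p [q [r [Hp _]]]]; [lra|lra|].
    apply (differentiable_pt_lim_continuous _ _ _ _ _ Hp).
Qed.

Local Lemma ex_RInt_vertical (c' d' x x' : R) :
  (c <= c')%R -> (c' <= d')%R -> (d' <= d)%R -> (a <= x <= b)%R -> (a <= x' <= b)%R ->
  ex_RInt (fun y => Q x y - Q x' y)%R c' d'.
Proof.
  intros. apply ex_RInt_cont; [assumption|]. intros y Hy.
  apply (continuous_minus (V := R_NormedModule) (fun y => Q x y) (fun y => Q x' y)).
  - destruct (closed x y) as [p [q [r [_ Hq]]]]; [lra|lra|].
    apply (differentiable_pt_lim_continuous _ _ _ _ _ Hq).
  - destruct (closed x' y) as [p [q [r [_ Hq]]]]; [lra|lra|].
    apply (differentiable_pt_lim_continuous _ _ _ _ _ Hq).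
Qed.

Local Lemma boundary_int_split_x (a' b' c' d' m : R) :
  inside a' b' c' d' -> (a' <= m <= b')%R ->
  boundary_int P Q a' b' c' d' =
    (boundary_int P Q a' m c' d' + boundary_int P Q m b' c' d')%R.
Proof.
  intros [H1 [H2 [H3 [H4 [H5 H6]]]]] Hm. unfold boundary_int.
  rewrite <- (RInt_Chasles (fun x => P x c' - P x d')%R a' m b')
    by (apply ex_RInt_horizontal; lra).
  assert (E : RInt (fun y => Q b' y - Q a' y)%R c' d' =
    plus (RInt (fun y => Q m y - Q a' y)%R c' d') (RInt (fun y => Q b' y - Q m y)%R c' d')).
  { rewrite <- (RInt_plus (V := R_CompleteNormedModule)) by (apply ex_RInt_vertical; lra).
    apply RInt_ext. intros y _. unfold plus; simpl. ring. }
  rewrite E. unfold plus; simpl. ring.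
Qed.

Local Lemma boundary_int_split_y (a' b' c' d' m : R) :
  inside a' b' c' d' -> (c' <= m <= d')%R ->
  boundary_int P Q a' b' c' d' =
    (boundary_int P Q a' b' c' m + boundary_int P Q a' b' m d')%R.
Proof.
  intros [H1 [H2 [H3 [H4 [H5 H6]]]]] Hm. unfold boundary_int.
  rewrite <- (RInt_Chasles (fun y => Q b' y - Q a' y)%R c' m d')
    by (apply ex_RInt_vertical; lra).
  assert (E : RInt (fun x => P x c' - P x d')%R a' b' =
    plus (RInt (fun x => P x c' - P x m)%R a' b') (RInt (fun x => P x m - P x d')%R a' b')).
  { rewrite <- (RInt_plus (V := R_CompleteNormedModule)) by (apply ex_RInt_horizontal; lra).
    apply RInt_ext. intros x _. unfold plus; simpl. ring. }
  rewrite E. unfold plus; simpl. ring.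
Qed.

Let rect : Type := (R * R * R * R)%type.

(** The factor 4 balances the later estimate: the local bound is quadratic in the side lengths, so
    halving the sides also divides it by 4. *)
Let halving (s t : rect) : Prop :=
  let '(a0, b0, c0, d0) := s in
  let '(a1, b1, c1, d1) := t in
  inside a1 b1 c1 d1 /\ (a0 <= a1 /\ b1 <= b0 /\ c0 <= c1 /\ d1 <= d0)%R /\
  (b1 - a1 = (b0 - a0) / 2)%R /\ (d1 - c1 = (d0 - c0) / 2)%R /\
  (Rabs (boundary_int P Q a0 b0 c0 d0) <= 4 * Rabs (boundary_int P Q a1 b1 c1 d1))%R.

Local Lemma halving_exists (a0 b0 c0 d0 : R) :
  inside a0 b0 c0 d0 -> exists t, halving (a0, b0, c0, d0) t.
Proof.
  intros Hin. set (m := ((a0 + b0) / 2)%R). set (k := ((c0 + d0) / 2)%R).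
  assert (Hin' := Hin). destruct Hin' as [H1 [H2 [H3 [H4 [H5 H6]]]]].
  assert (Hm : (a0 <= m <= b0)%R) by (unfold m; lra).
  assert (Hk : (c0 <= k <= d0)%R) by (unfold k; lra).
  assert (Hm1 : (m - a0 = (b0 - a0) / 2)%R) by (unfold m; lra).
  assert (Hm2 : (b0 - m = (b0 - a0) / 2)%R) by (unfold m; lra).
  assert (Hk1 : (k - c0 = (d0 - c0) / 2)%R) by (unfold k; lra).
  assert (Hk2 : (d0 - k = (d0 - c0) / 2)%R) by (unfold k; lra).
  clearbody m k.
  set (W := Rabs (boundary_int P Q a0 b0 c0 d0)).
  set (I1 := boundary_int P Q a0 m c0 k). set (I2 := boundary_int P Q a0 m k d0).
  set (I3 := boundary_int P Q m b0 c0 k). set (I4 := boundary_int P Q m b0 k d0).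
  assert (E : (W <= Rabs I1 + Rabs I2 + (Rabs I3 + Rabs I4))%R).
  { unfold W. rewrite (boundary_int_split_x _ _ _ _ m Hin Hm).
    rewrite (boundary_int_split_y a0 m c0 d0 k), (boundary_int_split_y m b0 c0 d0 k)
      by (unfold inside; lra).
    fold I1 I2 I3 I4.
    eapply Rle_trans; [apply Rabs_triang|].
    apply Rplus_le_compat; apply Rabs_triang. }
  destruct (Rle_dec W (4 * Rabs I1)) as [L1|L1];
    [exists (a0, m, c0, k); unfold halving, inside; fold W I1; lra|].
  destruct (Rle_dec W (4 * Rabs I2)) as [L2|L2];
    [exists (a0, m, k, d0); unfold halving, inside; fold W I2; lra|].
  destruct (Rle_dec W (4 * Rabs I3)) as [L3|L3];
    [exists (m, b0, c0, k); unfold halving, inside; fold W I3; lra|].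
  exists (m, b0, k, d0); unfold halving, inside; fold W I4; lra.
Qed.

(** The affine approximation contributes nothing: the horizontal pair gives
    [(b' - a') * (q * (c' - d'))] and the vertical pair [(d' - c') * (q * (b' - a'))], which cancel
    because [q] is shared. Only the error [e] on the four sides survives. *)
Local Lemma boundary_int_local (x0 y0 p q r P0 Q0 e a' b' c' d' : R) :
  inside a' b' c' d' ->
  (forall x y, (a' <= x <= b')%R -> (c' <= y <= d')%R ->
     (Rabs (P x y - P0 - (p * (x - x0) + q * (y - y0))) <= e)%R /\
     (Rabs (Q x y - Q0 - (q * (x - x0) + r * (y - y0))) <= e)%R) ->
  (Rabs (boundary_int P Q a' b' c' d') <= 2 * e * ((b' - a') + (d' - c')))%R.
Proof.
  intros [H1 [H2 [H3 [H4 [H5 H6]]]]] H. unfold boundary_int.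
  assert (E1 : (Rabs (RInt (fun x => P x c' - P x d') a' b' - (b' - a') * (q * (c' - d')))
                <= (b' - a') * (2 * e))%R).
  { change ((b' - a') * (q * (c' - d')))%R with (scal (b' - a') (q * (c' - d')))%R.
    rewrite <- (RInt_const (V := R_CompleteNormedModule)).
    change Rminus with (@minus R_AbelianGroup) at 1.
    rewrite <- (RInt_minus (V := R_CompleteNormedModule));
      [|apply ex_RInt_horizontal; lra|apply ex_RInt_const].
    apply abs_RInt_le_const; [assumption| |].
    - apply (ex_RInt_minus (V := R_NormedModule));
        [apply ex_RInt_horizontal; lra|apply ex_RInt_const].
    - intros x Hx. destruct (H x c') as [A _]; [lra|lra|].
      destruct (H x d') as [B _]; [lra|lra|].
      unfold minus, plus, opp; simpl. apply Rabs_le.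
      apply Rabs_le_between in A, B. lra. }
  assert (E2 : (Rabs (RInt (fun y => Q b' y - Q a' y) c' d' - (d' - c') * (q * (b' - a')))
                <= (d' - c') * (2 * e))%R).
  { change ((d' - c') * (q * (b' - a')))%R with (scal (d' - c') (q * (b' - a')))%R.
    rewrite <- (RInt_const (V := R_CompleteNormedModule)).
    change Rminus with (@minus R_AbelianGroup) at 1.
    rewrite <- (RInt_minus (V := R_CompleteNormedModule));
      [|apply ex_RInt_vertical; lra|apply ex_RInt_const].
    apply abs_RInt_le_const; [assumption| |].
    - apply (ex_RInt_minus (V := R_NormedModule));
        [apply ex_RInt_vertical; lra|apply ex_RInt_const].
    - intros y Hy. destruct (H b' y) as [_ A]; [lra|lra|].
      destruct (H a' y) as [_ B]; [lra|lra|].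
      unfold minus, plus, opp; simpl. apply Rabs_le.
      apply Rabs_le_between in A, B. lra. }
  apply Rabs_le_between in E1, E2. apply Rabs_le. lra.
Qed.

Local Lemma nested_point (u v : nat -> R) :
  (forall n, (u n <= u (S n))%R) -> (forall n, (v (S n) <= v n)%R) ->
  (forall n, (u n <= v n)%R) -> exists x, forall n, (u n <= x <= v n)%R.
Proof.
  intros Hu Hv Huv.
  assert (Mu : forall n k, (u n <= u (n + k)%nat)%R).
  { intros n k. induction k as [|k IH]; [rewrite Nat.add_0_r; lra|].
    rewrite Nat.add_succ_r. specialize (Hu (n + k)%nat). lra. }
  assert (Mv : forall n k, (v (n + k)%nat <= v n)%R).
  { intros n k. induction k as [|k IH]; [rewrite Nat.add_0_r; lra|].
    rewrite Nat.add_succ_r. specialize (Hv (n + k)%nat). lra. }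
  assert (M : forall n m, (u n <= v m)%R).
  { intros n m. pose proof (Mu n m). pose proof (Mv m n). pose proof (Huv (n + m)%nat).
    rewrite Nat.add_comm in H0. lra. }
  destruct (completeness (fun r => exists n, r = u n)) as [x [Hx1 Hx2]].
  - exists (v O). intros r [n ->]. apply M.
  - exists (u O), O. reflexivity.
  - exists x. intros n. split.
    + apply Hx1. now exists n.
    + apply Hx2. intros r [m ->]. apply M.
Qed.

(** Goursat's argument. After [n] bisections the integral is still at least [W / 4 ^ n], while
    differentiability at the common point of the rectangles bounds it by
    [2 * eps * (L / 2 ^ n) ^ 2]. Hence [W <= 2 * eps * L ^ 2] for every [eps]. *)
Lemma boundary_int_closed : (a <= b)%R -> (c <= d)%R -> boundary_int P Q a b c d = 0%R.
Proof.
  intros Hab Hcd.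
  (* A suitable quarter is available only for rectangles inside the given one, so choice is applied
     to the conditional statement, with a dummy successor elsewhere. *)
  destruct (functional_choice (fun s t : rect => let '(a0, b0, c0, d0) := s in
     inside a0 b0 c0 d0 -> halving s t)) as [next Hnext].
  { intros [[[a0 b0] c0] d0]. destruct (classic (inside a0 b0 c0 d0)) as [Hi|Hi].
    - destruct (halving_exists _ _ _ _ Hi) as [t Ht]. exists t. auto.
    - exists (0, 0, 0, 0)%R. intros K; contradiction. }
  set (s := fix s n := match n with O => (a, b, c, d) | S n => next (s n) end).
  set (u := fun n => fst (fst (fst (s n)))). set (v := fun n => snd (fst (fst (s n)))).
  set (u' := fun n => snd (fst (s n))). set (v' := fun n => snd (s n)).
  assert (Es : forall n, s n = (u n, v n, u' n, v' n)).
  { intros n. unfold u, v, u', v'. now destruct (s n) as [[[? ?] ?] ?]. }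
  set (W := Rabs (boundary_int P Q a b c d)).
  assert (Hin : forall n, inside (u n) (v n) (u' n) (v' n)).
  { induction n as [|n IH].
    - unfold u, v, u', v', inside; simpl. lra.
    - pose proof (Hnext (s n)) as K. rewrite Es in K. specialize (K IH).
      rewrite <- Es in K. change (next (s n)) with (s (S n)) in K.
      rewrite Es in K. unfold halving in K. rewrite (Es (S n)) in K. apply K. }
  assert (Hst : forall n, halving (s n) (s (S n))).
  { intros n. pose proof (Hnext (s n)) as K. rewrite Es in K.
    specialize (K (Hin n)). rewrite <- Es in K. exact K. }
  assert (Hst' : forall n, halving (u n, v n, u' n, v' n) (u (S n), v (S n), u' (S n), v' (S n))).
  { intros n. rewrite <- !Es. apply Hst. }
  unfold halving in Hst'.
  destruct (nested_point u v) as [x Hx];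
    try (intros n; destruct (Hst' n) as [_ [K _]]; lra).
  { intros n. destruct (Hin n) as [_ [K _]]; lra. }
  destruct (nested_point u' v') as [y Hy];
    try (intros n; destruct (Hst' n) as [_ [K _]]; lra).
  { intros n. destruct (Hin n) as [_ [_ [_ [_ [K _]]]]]; lra. }
  assert (Hlen : forall n, (v n - u n = (b - a) / 2 ^ n /\ v' n - u' n = (d - c) / 2 ^ n)%R).
  { induction n as [|n [IH1 IH2]].
    - unfold u, v, u', v'; simpl. lra.
    - destruct (Hst' n) as [_ [_ [K1 [K2 _]]]]. rewrite K1, K2, IH1, IH2. simpl.
      pose proof (pow_lt 2 n ltac:(lra)). split; field; lra. }
  assert (HW : forall n, (W <= 4 ^ n * Rabs (boundary_int P Q (u n) (v n) (u' n) (v' n)))%R).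
  { induction n as [|n IH].
    - unfold W, u, v, u', v'; simpl. lra.
    - destruct (Hst' n) as [_ [_ [_ [_ K]]]]. simpl.
      pose proof (pow_lt 4 n ltac:(lra)).
      apply Rle_trans with (1 := IH). rewrite (Rmult_comm 4), Rmult_assoc.
      apply Rmult_le_compat_l; lra. }
  set (L := ((b - a) + (d - c))%R). assert (HL : (0 <= L)%R) by (unfold L; lra).
  assert (Key : forall eps, (0 < eps)%R -> (W <= 2 * eps * L ^ 2)%R).
  { intros eps He.
    pose proof (Hx O) as Hx0. pose proof (Hy O) as Hy0.
    unfold u, v, u', v' in Hx0, Hy0; simpl in Hx0, Hy0.
    destruct (closed x y Hx0 Hy0) as [p [q [r [Dp Dq]]]].
    destruct (Dp (mkposreal eps He)) as [d1 Hd1].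
    destruct (Dq (mkposreal eps He)) as [d2 Hd2]. simpl in Hd1, Hd2.
    assert (Hdm : (0 < Rmin d1 d2)%R) by (apply Rmin_glb_lt; apply cond_pos).
    (* The [+ 1] yields the strict inequality [L / 2 ^ n < Rmin d1 d2], also when [L] is 0. *)
    destruct (Pow_x_infinity 2 ltac:(rewrite Rabs_pos_eq; lra) ((L + 1) / Rmin d1 d2)%R)
      as [n Hn].
    specialize (Hn n (Nat.le_refl _)).
    pose proof (pow_lt 2 n ltac:(lra)) as Hp2.
    rewrite Rabs_pos_eq in Hn by lra.
    destruct (Hlen n) as [E1 E2].
    assert (EL : ((v n - u n) + (v' n - u' n) = L / 2 ^ n)%R)
      by (rewrite E1, E2; unfold L; field; lra).
    assert (Hsmall : (L / 2 ^ n < Rmin d1 d2)%R).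
    { apply Rmult_lt_reg_r with (2 ^ n)%R; [exact Hp2|].
      unfold Rdiv. rewrite Rmult_assoc, Rinv_l, Rmult_1_r by lra.
      apply Rge_le in Hn.
      apply (Rmult_le_compat_l (Rmin d1 d2)) in Hn; [|lra].
      replace (Rmin d1 d2 * ((L + 1) / Rmin d1 d2))%R with (L + 1)%R in Hn by (field; lra).
      lra. }
    destruct (Hin n) as [I1 [I2 [I3 [I4 [I5 I6]]]]].
    pose proof (Hx n) as Hxn. pose proof (Hy n) as Hyn.
    pose proof (Rmin_l d1 d2). pose proof (Rmin_r d1 d2).
    assert (B := boundary_int_local x y p q r (P x y) (Q x y) (eps * (L / 2 ^ n))
       (u n) (v n) (u' n) (v' n) (Hin n)).
    assert (BB : (Rabs (boundary_int P Q (u n) (v n) (u' n) (v' n)) <=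
       2 * (eps * (L / 2 ^ n)) * (v n - u n + (v' n - u' n)))%R).
    { apply B. intros x1 y1 Hx1 Hy1.
      assert (A1 : (Rabs (x1 - x) <= L / 2 ^ n)%R) by (apply Rabs_le; lra).
      assert (A2 : (Rabs (y1 - y) <= L / 2 ^ n)%R) by (apply Rabs_le; lra).
      assert (A3 : (eps * Rmax (Rabs (x1 - x)) (Rabs (y1 - y)) <= eps * (L / 2 ^ n))%R)
        by (apply Rmult_le_compat_l; [lra|now apply Rmax_lub]).
      split; eapply Rle_trans; try exact A3; [apply Hd1|apply Hd2]; lra. }
    rewrite EL in BB.
    apply Rle_trans with (1 := HW n).
    assert (E4 : (4 ^ n = 2 ^ n * 2 ^ n)%R).
    { rewrite <- Rpow_mult_distr. f_equal. }
    rewrite E4.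
    apply (Rmult_le_compat_l (2 ^ n * 2 ^ n)) in BB; [|nra].
    apply Rle_trans with (1 := BB). right. field; lra. }
  assert (W0 : (W <= 0)%R).
  { apply Rnot_lt_le. intros HWp.
    assert (HL2 : (0 <= L ^ 2)%R) by apply pow2_ge_0.
    (* For this value [Key] reads [W <= W * L ^ 2 / (2 * (L ^ 2 + 1))], whose right side is below
       [W / 2] when [W] is positive. *)
    specialize (Key (W / (4 * (L ^ 2 + 1)))%R
      ltac:(apply Rdiv_lt_0_compat; lra)).
    apply (Rmult_le_compat_l (4 * (L ^ 2 + 1))) in Key; [|lra].
    replace (4 * (L ^ 2 + 1) * (2 * (W / (4 * (L ^ 2 + 1))) * L ^ 2))%R
      with (2 * W * L ^ 2)%R in Key by (field; lra).
    nra. }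
  unfold W in W0. apply Rabs_eq_0. pose proof (Rabs_pos (boundary_int P Q a b c d)). lra.
Qed.

End Rectangle.

(** * Circle means *)

Lemma two_PI_pos : (0 < 2 * PI)%R.
Proof. pose proof PI_RGT_0; lra. Qed.

Definition circ (r t : R) : C := (r * cos t, r * sin t)%R.

Definition mean (r : R) (F : C -> C) : C :=
  (RInt (fun t => Re (F (circ r t))) 0 (2 * PI) / (2 * PI),
   RInt (fun t => Im (F (circ r t))) 0 (2 * PI) / (2 * PI))%R.

(** Continuity is that of a function on the plane, not merely along the circle, so that the [ccont]
    and [holo] rules apply directly. *)
Definition circle_cont (r : R) (F : C -> C) : Prop :=
  forall z : C, Cmod z = r -> ccont F z.

Lemma Cmod_circ (r t : R) : (0 <= r)%R -> Cmod (circ r t) = r.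
Proof.
  intros Hr. unfold Cmod, circ; simpl.
  replace (r * cos t * (r * cos t * 1) + r * sin t * (r * sin t * 1))%R
    with (r ^ 2 * (Rsqr (sin t) + Rsqr (cos t)))%R by (unfold Rsqr; ring).
  rewrite sin2_cos2, Rmult_1_r. now apply sqrt_pow2.
Qed.

Lemma Rabs_Im_le_Cmod (z : C) : (Rabs (Im z) <= Cmod z)%R.
Proof. eapply Rle_trans; [|apply Rmax_Cmod]. apply Rmax_r. Qed.

Lemma Cmod_le_Re_Im (z : C) : (Cmod z <= Rabs (Re z) + Rabs (Im z))%R.
Proof.
  destruct z as [x y]. replace (x, y) with (RtoC x + Ci * RtoC y)
    by (unfold Ci, RtoC, Cplus, Cmult; simpl; f_equal; ring).
  eapply Rle_trans; [apply Cmod_triangle|].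
  rewrite Cmod_mult, Cmod_Ci, !Cmod_R. simpl.
  right. f_equal; [f_equal; ring|]. rewrite Rmult_1_l. f_equal. ring.
Qed.

Lemma circ_near (r t : R) (d : R) : (0 < d)%R ->
  locally t (fun u => (Cmod (circ r u - circ r t) < d)%R).
Proof.
  intros Hd.
  assert (K : forall g : R -> R, continuous g t ->
    locally t (fun u => (Rabs (r * g u - r * g t) < d / 2)%R)).
  { intros g Hg.
    assert (Hg' : continuous (fun u => r * g u)%R t)
      by (apply (continuous_mult (fun _ => r) g); [apply continuous_const|exact Hg]).
    apply continuity_pt_filterlim in Hg'. rewrite continuity_pt_locally in Hg'.
    exact (Hg' (mkposreal (d / 2) ltac:(lra))). }
  pose proof (K cos (continuous_cos t)) as K1. pose proof (K sin (continuous_sin t)) as K2.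
  generalize (filter_and _ _ K1 K2). apply filter_imp. intros u [A B].
  eapply Rle_lt_trans; [apply Cmod_le_Re_Im|]. unfold circ; simpl. unfold Rminus in A, B. lra.
Qed.

Lemma circle_cont_Re (r : R) (F : C -> C) (t : R) : (0 <= r)%R -> circle_cont r F ->
  continuous (fun u => Re (F (circ r u))) t /\ continuous (fun u => Im (F (circ r u))) t.
Proof.
  intros Hr H. specialize (H _ (Cmod_circ r t Hr)).
  split; apply continuity_pt_filterlim, continuity_pt_locally; intros eps;
    destruct (H eps (cond_pos eps)) as [d [Hd Hd']];
    generalize (circ_near r t d Hd); apply filter_imp; intros u Hu; specialize (Hd' (circ r u) Hu);
    (eapply Rle_lt_trans; [|exact Hd']).
  - apply (re_le_Cmod (F (circ r u) - F (circ r t))).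
  - apply (Rabs_Im_le_Cmod (F (circ r u) - F (circ r t))).
Qed.

Lemma circle_cont_ex_RInt (r : R) (F : C -> C) : (0 <= r)%R -> circle_cont r F ->
  ex_RInt (fun t => Re (F (circ r t))) 0 (2 * PI) /\
  ex_RInt (fun t => Im (F (circ r t))) 0 (2 * PI).
Proof.
  intros Hr H. pose proof two_PI_pos.
  split; apply ex_RInt_cont; try lra; intros t _; now apply circle_cont_Re.
Qed.

Lemma mean_ext (r : R) (F G : C -> C) : (0 <= r)%R ->
  (forall z, Cmod z = r -> F z = G z) -> mean r F = mean r G.
Proof.
  intros Hr E. unfold mean. f_equal; f_equal; apply RInt_ext; intros t _;
    now rewrite (E _ (Cmod_circ r t Hr)).
Qed.

Lemma mean_plus (r : R) (F G : C -> C) : (0 <= r)%R -> circle_cont r F -> circle_cont r G ->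
  mean r (fun z => F z + G z) = mean r F + mean r G.
Proof.
  intros Hr HF HG. pose proof two_PI_pos.
  destruct (circle_cont_ex_RInt r F Hr HF) as [F1 F2].
  destruct (circle_cont_ex_RInt r G Hr HG) as [G1 G2].
  pose proof (RInt_plus (V := R_CompleteNormedModule) _ _ _ _ F1 G1) as E1.
  pose proof (RInt_plus (V := R_CompleteNormedModule) _ _ _ _ F2 G2) as E2.
  unfold plus in E1, E2; simpl in E1, E2.
  unfold mean, Cplus; simpl. unfold Rdiv. rewrite <- !Rmult_plus_distr_r.
  rewrite <- E1, <- E2. reflexivity.
Qed.

Lemma mean_scal (r : R) (c : C) (F : C -> C) : (0 <= r)%R -> circle_cont r F ->
  mean r (fun z => c * F z) = c * mean r F.
Proof.
  intros Hr HF. pose proof two_PI_pos.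
  destruct (circle_cont_ex_RInt r F Hr HF) as [F1 F2].
  destruct c as [p q].
  assert (S : forall (k : R) f, ex_RInt f 0 (2 * PI) -> ex_RInt (fun t => k * f t)%R 0 (2 * PI))
    by (intros k f; apply (ex_RInt_scal (V := R_NormedModule))).
  assert (E : forall (k : R) f, ex_RInt f 0 (2 * PI) ->
    RInt (fun t => k * f t)%R 0 (2 * PI) = (k * RInt f 0 (2 * PI))%R)
    by (intros k f; apply (RInt_scal (V := R_CompleteNormedModule))).
  pose proof (RInt_minus (V := R_CompleteNormedModule) _ _ _ _ (S p _ F1) (S q _ F2)) as E1.
  pose proof (RInt_plus (V := R_CompleteNormedModule) _ _ _ _ (S p _ F2) (S q _ F1)) as E2.
  rewrite !E in E1, E2 by assumption.
  unfold minus, plus, opp in E1, E2; simpl in E1, E2.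
  unfold mean, Cmult; simpl. f_equal.
  - transitivity ((p * RInt (fun t => Re (F (circ r t))) 0 (2 * PI) +
      - (q * RInt (fun t => Im (F (circ r t))) 0 (2 * PI))) / (2 * PI))%R.
    + rewrite <- E1. reflexivity.
    + field. apply PI_neq0.
  - transitivity ((p * RInt (fun t => Im (F (circ r t))) 0 (2 * PI) +
      (q * RInt (fun t => Re (F (circ r t))) 0 (2 * PI))) / (2 * PI))%R.
    + rewrite <- E2. reflexivity.
    + field. apply PI_neq0.
Qed.

Lemma mean_const (r : R) (c : C) : mean r (fun _ => c) = c.
Proof.
  unfold mean. rewrite !RInt_const. unfold scal; simpl. unfold mult; simpl.
  destruct c as [x y]; simpl. f_equal; field; apply PI_neq0.
Qed.

Lemma circle_cont_plus (r : R) (F G : C -> C) :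
  circle_cont r F -> circle_cont r G -> circle_cont r (fun z => F z + G z).
Proof. intros HF HG z Hz. apply ccont_plus; auto. Qed.

Lemma circle_cont_minus (r : R) (F G : C -> C) :
  circle_cont r F -> circle_cont r G -> circle_cont r (fun z => F z - G z).
Proof. intros HF HG z Hz. apply ccont_minus; auto. Qed.

Lemma circle_cont_mult (r : R) (F G : C -> C) :
  circle_cont r F -> circle_cont r G -> circle_cont r (fun z => F z * G z).
Proof. intros HF HG z Hz. apply ccont_mult; auto. Qed.

Lemma circle_cont_const (r : R) (c : C) : circle_cont r (fun _ => c).
Proof. intros z Hz. apply ccont_const. Qed.

Lemma circle_cont_conj (r : R) (F : C -> C) :
  circle_cont r F -> circle_cont r (fun z => Cconj (F z)).
Proof. intros HF z Hz. apply ccont_conj; auto. Qed.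

Lemma mean_minus (r : R) (F G : C -> C) : (0 <= r)%R -> circle_cont r F -> circle_cont r G ->
  mean r (fun z => F z - G z) = mean r F - mean r G.
Proof.
  intros Hr HF HG.
  rewrite (mean_ext r _ (fun z => F z + (- (1)) * G z) Hr) by (intros; ring).
  rewrite mean_plus, mean_scal; auto.
  - ring.
  - apply circle_cont_mult; [apply circle_cont_const|exact HG].
Qed.

Lemma mean_sum_n (r : R) (F : nat -> C -> C) (n : nat) : (0 <= r)%R ->
  (forall k, (k <= n)%nat -> circle_cont r (F k)) ->
  mean r (fun z => sum_n (fun k => F k z) n) = sum_n (fun k => mean r (F k)) n.
Proof.
  intros Hr. induction n as [|n IH]; intros H.
  - rewrite sum_O. apply mean_ext; [exact Hr|]. intros. now rewrite sum_O.
  - rewrite sum_Sn, <- IH by (intros; apply H; lia).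
    change plus with Cplus. rewrite <- mean_plus.
    + apply mean_ext; [exact Hr|]. intros. now rewrite sum_Sn.
    + exact Hr.
    + intros z Hz. apply ccont_sum_n. intros k Hk. apply H; [lia|exact Hz].
    + apply H. lia.
Qed.

(** The factor 2 comes from bounding real and imaginary parts separately. It is harmless: each use
    either lets the bound tend to 0 or asks for some uniform bound. *)
Lemma mean_bound (r M : R) (F : C -> C) : (0 <= r)%R -> circle_cont r F ->
  (forall t, (0 <= t <= 2 * PI)%R -> (Cmod (F (circ r t)) <= M)%R) ->
  (Cmod (mean r F) <= 2 * M)%R.
Proof.
  intros Hr HF B. pose proof two_PI_pos as Hp.
  destruct (circle_cont_ex_RInt r F Hr HF) as [F1 F2].
  assert (K : forall f, ex_RInt f 0 (2 * PI) ->
    (forall t, (0 <= t <= 2 * PI)%R -> (Rabs (f t) <= M)%R) ->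
    (Rabs (RInt f 0 (2 * PI) / (2 * PI)) <= M)%R).
  { intros f Hf Hb. unfold Rdiv. rewrite Rabs_mult, (Rabs_pos_eq (/ (2 * PI)))
      by (apply Rlt_le, Rinv_0_lt_compat; lra).
    apply Rmult_le_reg_r with (2 * PI)%R; [exact Hp|].
    rewrite Rmult_assoc, Rinv_l, Rmult_1_r by lra.
    pose proof (abs_RInt_le_const f 0 (2 * PI) M ltac:(lra) Hf Hb). lra. }
  eapply Rle_trans; [apply Cmod_le_Re_Im|]. unfold mean; simpl.
  pose proof (K _ F1 (fun t Ht => Rle_trans _ _ _ (re_le_Cmod _) (B t Ht))).
  pose proof (K _ F2 (fun t Ht => Rle_trans _ _ _ (Rabs_Im_le_Cmod _) (B t Ht))).
  simpl in *. lra.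
Qed.

Lemma mean_nonneg (r : R) (F : C -> C) : (0 <= r)%R -> circle_cont r F ->
  (forall z, Cmod z = r -> (0 <= Re (F z))%R /\ Im (F z) = 0%R) ->
  (0 <= Re (mean r F))%R /\ Im (mean r F) = 0%R.
Proof.
  intros Hr HF H. pose proof two_PI_pos as Hp.
  destruct (circle_cont_ex_RInt r F Hr HF) as [F1 _].
  unfold mean; simpl. split.
  - apply Rmult_le_pos; [|apply Rlt_le, Rinv_0_lt_compat; lra].
    apply RInt_ge_0; [lra|exact F1|]. intros t _. apply H, Cmod_circ, Hr.
  - rewrite (RInt_ext _ (fun _ => 0%R)).
    + rewrite RInt_const. unfold scal; simpl. unfold mult; simpl. unfold Rdiv. ring.
    + intros t _. apply H, Cmod_circ, Hr.
Qed.

(** The Cauchy-Riemann equations: in real coordinates multiplication by [l] has rows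
    [(Re l, - Im l)] and [(Im l, Re l)]. Halving [eps] pays for replacing the modulus by the larger
    coordinate. *)
Lemma cderiv_differentiable (F : C -> C) (x y : R) (l : C) : cderiv F (x, y) l ->
  differentiable_pt_lim (fun u v => Re (F (u, v))) x y (Re l) (- Im l) /\
  differentiable_pt_lim (fun u v => Im (F (u, v))) x y (Im l) (Re l).
Proof.
  intros H.
  assert (K : forall eps : posreal, locally_2d (fun u v =>
    (Cmod (F (u, v) - F (x, y) - l * ((u, v) - (x, y))) <=
      eps * Rmax (Rabs (u - x)) (Rabs (v - y)))%R) x y).
  { intros eps. destruct (H (eps / 2)%R) as [d [Hd Hd']].
    { pose proof (cond_pos eps); lra. }
    exists (mkposreal (d / 2) ltac:(lra)). simpl. intros u v Hu Hv.
    pose proof (Cmod_le_Re_Im ((u, v) - (x, y))) as B. simpl in B.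
    fold (u - x)%R in B. fold (v - y)%R in B.
    eapply Rle_trans; [apply Hd'; lra|].
    pose proof (Rmax_l (Rabs (u - x)) (Rabs (v - y))).
    pose proof (Rmax_r (Rabs (u - x)) (Rabs (v - y))).
    pose proof (cond_pos eps).
    apply Rle_trans with (eps / 2 * (2 * Rmax (Rabs (u - x)) (Rabs (v - y))))%R.
    - apply Rmult_le_compat_l; lra.
    - right. field. }
  split; intros eps; generalize (K eps); apply locally_2d_impl, locally_2d_forall;
    intros u v Huv; (eapply Rle_trans; [|exact Huv]).
  - eapply Rle_trans; [|apply re_le_Cmod]. right. f_equal.
    destruct l as [p q]; unfold Re, Im; simpl. ring.
  - eapply Rle_trans; [|apply Rabs_Im_le_Cmod]. right. f_equal.
    destruct l as [p q]; unfold Re, Im; simpl. ring.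
Qed.

(** Used with [g] equal to [cos] and [sin], which gives the two coordinates of exp (s + i t). *)
Lemma differentiable_exp_mult (g : R -> R) (s t l : R) : derivable_pt_lim g t l ->
  differentiable_pt_lim (fun s t => exp s * g t)%R s t (exp s * g t) (exp s * l).
Proof.
  intros Hg.
  assert (Pm : forall x y : R, differentiable_pt_lim Rmult x y y x).
  { intros x y eps. exists eps. intros u v Hu Hv.
    replace (u * v - x * y - (y * (u - x) + x * (v - y)))%R with ((u - x) * (v - y))%R by ring.
    rewrite Rabs_mult. apply Rmult_le_compat; try apply Rabs_pos; [lra|apply Rmax_r]. }
  assert (P2 : differentiable_pt_lim (fun _ v => v) s t 0 1).
  { intros eps. exists eps. intros u v Hu Hv.
    replace (v - t - (0 * (u - s) + 1 * (v - t)))%R with 0%R by ring. rewrite Rabs_R0.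
    apply Rmult_le_pos; [apply Rlt_le, cond_pos|].
    eapply Rle_trans; [apply Rabs_pos|apply Rmax_l]. }
  assert (Pe : differentiable_pt_lim (fun u _ => exp u) s t (exp s) 0)
    by (apply differentiable_pt_lim_proj1_0, derivable_pt_lim_exp).
  assert (Pg : differentiable_pt_lim (fun _ v => g v) s t 0 l).
  { pose proof (differentiable_pt_lim_comp (fun u _ => g u) (fun _ v => v) (fun _ v => v)
      s t l 0 0 1 0 1 (differentiable_pt_lim_proj1_0 g t t l Hg) P2 P2) as K.
    replace (l * 0 + 0 * 0)%R with 0%R in K by ring.
    replace (l * 1 + 0 * 1)%R with l in K by ring. exact K. }
  pose proof (differentiable_pt_lim_comp Rmult (fun u _ => exp u) (fun _ v => g v)
    s t _ _ _ _ _ _ (Pm _ _) Pe Pg) as K.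
  replace (g t * exp s + exp s * 0)%R with (exp s * g t)%R in K by ring.
  replace (g t * 0 + exp s * l)%R with (exp s * l)%R in K by ring. exact K.
Qed.

(* In the coordinates z = exp (s + i t) the circle |z| = r becomes a vertical segment, and
   periodicity cancels the two horizontal sides of the rectangle. *)
Lemma mean_annulus (r1 r2 : R) (F : C -> C) : (0 < r1)%R -> (r1 <= r2)%R ->
  (forall z, (r1 <= Cmod z <= r2)%R -> holo F z) -> mean r1 F = mean r2 F.
Proof.
  intros Hr1 Hr12 H. pose proof two_PI_pos as Hp.
  assert (Hr2 : (0 < r2)%R) by lra.
  set (s1 := ln r1). set (s2 := ln r2).
  assert (E1 : exp s1 = r1) by now apply exp_ln.
  assert (E2 : exp s2 = r2) by now apply exp_ln.
  assert (Hs : (s1 <= s2)%R) by (now apply ln_le).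
  set (U := fun s t : R => Re (F (circ (exp s) t))).
  set (V := fun s t : R => Im (F (circ (exp s) t))).
  (* The Cauchy-Riemann equations survive the change of coordinates, because the complex exponential
     is itself analytic. *)
  assert (D : forall s t, (s1 <= s <= s2)%R -> exists p q,
    (differentiable_pt_lim U s t p q /\ differentiable_pt_lim V s t (- q) p)%R).
  { intros s t Hst.
    destruct (H (circ (exp s) t)) as [l Hl].
    { rewrite Cmod_circ by apply Rlt_le, exp_pos. rewrite <- E1, <- E2.
      assert (Hle : forall x y, (x <= y)%R -> (exp x <= exp y)%R).
    { intros x y [Hxy| ->]; [now apply Rlt_le, exp_increasing|lra]. }
    split; apply Hle; lra. }
    apply cderiv_differentiable in Hl. destruct Hl as [Hu Hv].
    pose proof (differentiable_exp_mult cos s t _ (derivable_pt_lim_cos t)) as Dc.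
    pose proof (differentiable_exp_mult sin s t _ (derivable_pt_lim_sin t)) as Ds.
    pose proof (differentiable_pt_lim_comp _ _ _ s t _ _ _ _ _ _ Hu Dc Ds) as Ku.
    pose proof (differentiable_pt_lim_comp _ _ _ s t _ _ _ _ _ _ Hv Dc Ds) as Kv.
    eexists. eexists. split; [exact Ku|].
    match goal with |- differentiable_pt_lim _ _ _ ?p ?q =>
      match type of Kv with differentiable_pt_lim _ _ _ ?p' ?q' =>
        replace p with p' by ring; replace q with q' by ring end end.
    exact Kv. }
  assert (CU : forall s t, (s1 <= s <= s2)%R ->
    continuous (fun v => U s v) t /\ continuous (fun v => V s v) t).
  { intros s t Hst. destruct (D s t Hst) as [p [q [Hu Hv]]].
    split; [apply (differentiable_pt_lim_continuous _ _ _ _ _ Hu)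
           |apply (differentiable_pt_lim_continuous _ _ _ _ _ Hv)]. }
  assert (Per : forall s, circ (exp s) (2 * PI) = circ (exp s) 0).
  { intros s. unfold circ. now rewrite cos_2PI, sin_2PI, cos_0, sin_0. }
  assert (K : forall P Q : R -> R -> R,
    (forall s t, (s1 <= s <= s2)%R -> closed_form_at P Q s t) ->
    (forall s, P s (2 * PI) = P s 0)%R ->
    (forall s t, (s1 <= s <= s2)%R -> continuous (fun v => Q s v) t) ->
    RInt (fun t => Q s1 t) 0 (2 * PI) = RInt (fun t => Q s2 t) 0 (2 * PI)).
  { intros P Q HPQ HP HQ.
    pose proof (boundary_int_closed P Q s1 s2 0 (2 * PI)
      (fun s t Hs' _ => HPQ s t Hs') Hs (Rlt_le _ _ Hp)) as Z.
    unfold boundary_int in Z.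
    assert (Z0 : RInt (fun x => P x 0 - P x (2 * PI))%R s1 s2 = 0%R).
    { rewrite (RInt_ext _ (fun _ => 0%R)) by (intros x _; rewrite HP; apply Rminus_diag).
      rewrite RInt_const. unfold scal; simpl. unfold mult; simpl. ring. }
    rewrite Z0 in Z.
    assert (M := RInt_minus (V := R_CompleteNormedModule) (fun y => Q s2 y) (fun y => Q s1 y)
      0 (2 * PI)).
    unfold minus, plus, opp in M; simpl in M. unfold Rminus in Z. rewrite M in Z.
    - lra.
    - apply ex_RInt_cont; [lra|]. intros t _. apply HQ; lra.
    - apply ex_RInt_cont; [lra|]. intros t _. apply HQ; lra. }
  unfold mean. rewrite <- E1, <- E2. f_equal; f_equal.
  (* On the strip F dz / z = (U + i V) (ds + i dt). Its imaginary part is V ds + U dt, and minus its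
     real part is - U ds + V dt; these are the two forms passed to [K], and their dt-coefficients
     are the two components of the mean. *)
  - apply (K V U).
    + intros s t Hst. destruct (D s t Hst) as [p [q [Hu Hv]]]. exists (- q)%R, p, q. auto.
    + intros s. unfold V. now rewrite Per.
    + intros s t Hst. now apply CU.
  - apply (K (fun s t => - U s t)%R V).
    + intros s t Hst. destruct (D s t Hst) as [p [q [Hu Hv]]].
      exists (- p)%R, (- q)%R, p. split; [|exact Hv].
      intros eps. generalize (Hu eps). apply locally_2d_impl, locally_2d_forall.
      intros u v Huv. eapply Rle_trans; [|exact Huv]. right.
      rewrite <- Rabs_Ropp. f_equal. ring.
    + intros s. unfold U. now rewrite Per.
    + intros s t Hst. now apply CU.
Qed.

(** * The Cauchy integral formula *)

Lemma ccont_comp (g f : C -> C) (z : C) :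
  ccont f z -> ccont g (f z) -> ccont (fun w => g (f w)) z.
Proof.
  intros Hf Hg eps He. destruct (Hg eps He) as [d [Hd H]].
  destruct (Hf d Hd) as [d' [Hd' H']]. exists d'. split; [exact Hd'|]. auto.
Qed.

Lemma eq0_of_Cmod_small (z : C) (k : R) :
  (forall eps, (0 < eps)%R -> (Cmod z <= k * eps)%R) -> z = 0.
Proof.
  intros H. apply Cmod_eq_0. pose proof (Cmod_ge_0 z).
  destruct (Rle_lt_dec (Cmod z) 0) as [L|L]; [lra|].
  exfalso. set (k' := (Rabs k + 1)%R).
  assert (Hk : (k < k' /\ 0 < k')%R).
  { unfold k'. pose proof (Rle_abs k). pose proof (Rabs_pos k). lra. }
  specialize (H (Cmod z / k')%R ltac:(apply Rdiv_lt_0_compat; lra)).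
  assert (k * (Cmod z / k') < k' * (Cmod z / k'))%R.
  { apply Rmult_lt_compat_r; [apply Rdiv_lt_0_compat; lra|lra]. }
  replace (k' * (Cmod z / k'))%R with (Cmod z) in H1 by (field; lra). lra.
Qed.

Lemma Csub_eq0 (x y : C) : x - y = 0 -> x = y.
Proof. intros E. replace x with (x - y + y) by ring. rewrite E. ring. Qed.

Lemma Csub_neq0 (x y : C) : x <> y -> x - y <> 0.
Proof. intros N E. now apply N, Csub_eq0. Qed.

Lemma Cmod_lt_neq (x y : C) : (Cmod x < Cmod y)%R -> y - x <> 0.
Proof. intros H. apply Csub_neq0. intros E. rewrite E in H. lra. Qed.

(** Moves two circles onto a common one, so that means over different radii can be subtracted under
    a single integral. *)
Lemma mean_rescale (r : R) (F : C -> C) : mean r F = mean 1 (fun z => F (r * z)).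
Proof.
  unfold mean. f_equal; f_equal; apply RInt_ext; intros t _; do 2 f_equal;
    unfold circ, RtoC, Cmult; simpl; f_equal; ring.
Qed.

Lemma circle_cont_rescale (r : R) (F : C -> C) : (0 <= r)%R -> circle_cont r F ->
  circle_cont 1 (fun z => F (r * z)).
Proof.
  intros Hr HF z Hz. apply (ccont_comp F (fun z => r * z)).
  - apply ccont_mult; [apply ccont_const|apply ccont_id].
  - apply HF. rewrite Cmod_mult, Hz, Cmod_R, Rabs_pos_eq; lra.
Qed.

Lemma continuity_2d_circ (c t : R) (H : C -> C) : ccont H (circ c t) ->
  continuity_2d_pt (fun t r => Re (H (circ r t))) t c /\
  continuity_2d_pt (fun t r => Im (H (circ r t))) t c.
Proof.
  intros HH.
  assert (K : forall g : R -> R, continuous g t ->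
    continuity_2d_pt (fun t r => r * g t)%R t c).
  { intros g Hg. apply (continuity_2d_pt_mult (fun _ r => r) (fun t _ => g t)).
    - intros eps. exists eps. auto.
    - apply continuity_pt_filterlim in Hg. intros eps.
      rewrite continuity_pt_locally in Hg. destruct (Hg eps) as [d Hd]. exists d. auto. }
  assert (N : forall d, (0 < d)%R ->
    locally_2d (fun u v => (Cmod (circ v u - circ c t) < d)%R) t c).
  { intros d Hd.
    pose proof (K cos (continuous_cos t) (mkposreal (d / 2) ltac:(lra))) as K1.
    pose proof (K sin (continuous_sin t) (mkposreal (d / 2) ltac:(lra))) as K2.
    generalize (locally_2d_and _ _ _ _ K1 K2).
    apply locally_2d_impl, locally_2d_forall. intros u v [A B]. simpl in A, B.
    eapply Rle_lt_trans; [apply Cmod_le_Re_Im|]. unfold circ; simpl.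
    unfold Rminus in A, B. lra. }
  split; intros eps; destruct (HH eps (cond_pos eps)) as [d [Hd Hd']];
    generalize (N d Hd); apply locally_2d_impl, locally_2d_forall; intros u v Huv;
    specialize (Hd' _ Huv); (eapply Rle_lt_trans; [|exact Hd']).
  - apply (re_le_Cmod (H (circ v u) - H (circ c t))).
  - apply (Rabs_Im_le_Cmod (H (circ v u) - H (circ c t))).
Qed.

Lemma mean_sub_bound (r1 r2 e : R) (F : C -> C) : (0 <= r1)%R -> (0 <= r2)%R ->
  circle_cont r1 F -> circle_cont r2 F ->
  (forall t, (0 <= t <= 2 * PI)%R -> (Cmod (F (circ r2 t) - F (circ r1 t)) <= e)%R) ->
  (Cmod (mean r2 F - mean r1 F) <= 2 * e)%R.
Proof.
  intros H1 H2 C1 C2 HF.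
  pose proof (circle_cont_rescale _ _ H1 C1) as D1.
  pose proof (circle_cont_rescale _ _ H2 C2) as D2.
  rewrite (mean_rescale r1), (mean_rescale r2), <- mean_minus by (auto; lra).
  apply mean_bound; [lra|now apply circle_cont_minus|].
  assert (E : forall r t : R, r * circ 1 t = circ r t)
    by (intros r t; unfold circ, RtoC, Cmult; simpl; f_equal; ring).
  intros t Ht. rewrite !E. now apply HF.
Qed.

(* Removability of a point at which the function is merely continuous. *)
Lemma mean_value_except (r : R) (z0 : C) (F : C -> C) : (Cmod z0 < r)%R ->
  (forall z, (Cmod z <= r)%R -> ccont F z) ->
  (forall z, (Cmod z <= r)%R -> z <> z0 -> z <> 0 -> holo F z) -> mean r F = F 0.
Proof.
  intros Hz0 HC HH.
  assert (Hr : (0 < r)%R) by (pose proof (Cmod_ge_0 z0); lra).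
  assert (CC : forall s, (s <= r)%R -> circle_cont s F) by (intros s Hs z Hz; apply HC; lra).
  (* Here the punctured disk of radius [s] avoids [z0], so the circle can be shrunk to 0, where
     continuity identifies the limit of the means. *)
  assert (Inner : forall s, (0 < s <= r)%R -> (s < Cmod z0 \/ z0 = 0)%R -> mean s F = F 0).
  { intros s Hs Hs0. apply Csub_eq0, (eq0_of_Cmod_small _ 2). intros eps He.
    destruct (HC 0) with (eps := eps) as [d [Hd Hd']]; [rewrite Cmod_0; lra|exact He|].
    set (u := Rmin s (d / 2)).
    assert (Hu : (0 < u)%R) by (apply Rmin_glb_lt; lra).
    assert (Hus : (u <= s)%R) by apply Rmin_l.
    assert (Hud : (u <= d / 2)%R) by apply Rmin_r.
    rewrite <- (mean_annulus u s F Hu Hus).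
    - rewrite <- (mean_const u (F 0)) at 1.
      rewrite <- mean_minus; [|lra|apply CC; lra|apply circle_cont_const].
      apply mean_bound; [lra|apply circle_cont_minus; [apply CC; lra|apply circle_cont_const]|].
      intros t _. apply Rlt_le, Hd'. replace (circ u t - 0) with (circ u t) by ring.
      rewrite Cmod_circ; lra.
    - intros z Hz. apply HH.
      + lra.
      + intros ->. destruct Hs0 as [Hs0| ->]; [lra|]. rewrite Cmod_0 in Hz. lra.
      + intros ->. rewrite Cmod_0 in Hz. lra. }
  destruct (Ceq_dec z0 0) as [E|N]; [apply Inner; [lra|now right]|].
  apply Cmod_pos in N. set (c := Cmod z0) in *.
  apply Csub_eq0, (eq0_of_Cmod_small _ 4). intros eps He.
  assert (K : forall t, (0 <= t <= 2 * PI)%R ->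
    continuity_2d_pt (fun t r => Re (F (circ r t))) t c /\
    continuity_2d_pt (fun t r => Im (F (circ r t))) t c).
  { intros t _. apply continuity_2d_circ, HC. rewrite Cmod_circ; lra. }
  (* The circle through [z0] is crossed by continuity alone: compactness of the angle interval makes
     it uniform, so the means at radii [c - h] and [c + h] are close. Real and imaginary parts cost
     [eps] each and [mean_sub_bound] doubles their sum, whence [4 * eps]. *)
  destruct (uniform_continuity_2d_1d _ 0 (2 * PI) c (fun t Ht => proj1 (K t Ht))
    (mkposreal eps He)) as [d1 H1].
  destruct (uniform_continuity_2d_1d _ 0 (2 * PI) c (fun t Ht => proj2 (K t Ht))
    (mkposreal eps He)) as [d2 H2]. simpl in H1, H2.
  set (d := Rmin d1 d2).
  assert (Hd : (0 < d)%R) by (apply Rmin_glb_lt; apply cond_pos).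
  assert (Hd1 : (d <= d1)%R) by apply Rmin_l. assert (Hd2 : (d <= d2)%R) by apply Rmin_r.
  set (h := (Rmin d (Rmin c (r - c)) / 2)%R).
  assert (Hh : (0 < h /\ h < d /\ h < c /\ h < r - c)%R).
  { unfold h. assert (0 < Rmin d (Rmin c (r - c)))%R by (repeat apply Rmin_glb_lt; lra).
    pose proof (Rmin_l d (Rmin c (r - c))). pose proof (Rmin_r d (Rmin c (r - c))).
    pose proof (Rmin_l c (r - c)). pose proof (Rmin_r c (r - c)). lra. }
  clearbody h.
  rewrite <- (Inner (c - h)%R) by (try left; lra).
  rewrite <- (mean_annulus (c + h) r F); [|lra|lra|].
  - replace (4 * eps)%R with (2 * (2 * eps))%R by ring.
    apply mean_sub_bound; [lra|lra|apply CC; lra|apply CC; lra|].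
    intros t Ht. eapply Rle_trans; [apply Cmod_le_Re_Im|].
    assert (A1 := H1 t (c - h)%R t (c + h)%R). assert (A2 := H2 t (c - h)%R t (c + h)%R).
    rewrite Rminus_diag, Rabs_R0 in A1, A2.
    specialize (A1 Ht ltac:(lra) Ht ltac:(lra) (cond_pos d1)).
    specialize (A2 Ht ltac:(lra) Ht ltac:(lra) (cond_pos d2)).
    change (Rabs (Re (F (circ (c + h) t)) - Re (F (circ (c - h) t))) +
      Rabs (Im (F (circ (c + h) t)) - Im (F (circ (c - h) t))) <= 2 * eps)%R. lra.
  - intros z Hz. apply HH; [lra| |].
    + intros ->. fold c in Hz. lra.
    + intros ->. rewrite Cmod_0 in Hz. lra.
Qed.

Lemma cauchy_kernel_holo (z0 z : C) : (Cmod z0 < Cmod z)%R -> holo (fun w => w / (w - z0)) z.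
Proof.
  intros H. unfold Cdiv. apply holo_mult; [apply holo_id|].
  apply holo_inv; [now apply Cmod_lt_neq|].
  apply holo_minus; [apply holo_id|apply holo_const].
Qed.

(** The kernel is analytic outside the circle, so the radius may be increased at will, and the
    kernel tends to 1 at infinity. The radius [r + / eps] makes its distance to 1 at most
    [Cmod z0 * eps]. *)
Lemma mean_cauchy_kernel (r : R) (z0 : C) : (Cmod z0 < r)%R ->
  mean r (fun z => z / (z - z0)) = 1.
Proof.
  intros Hz0. assert (Hr : (0 < r)%R) by (pose proof (Cmod_ge_0 z0); lra).
  assert (Hk : forall z, (r <= Cmod z)%R -> holo (fun w => w / (w - z0)) z)
    by (intros; apply cauchy_kernel_holo; lra).
  apply Csub_eq0, (eq0_of_Cmod_small _ (2 * Cmod z0)). intros eps He.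
  pose proof (Cmod_ge_0 z0).
  set (s := (r + / eps)%R).
  assert (He' := Rinv_0_lt_compat _ He).
  assert (Hs : (r <= s)%R) by (unfold s; lra).
  rewrite (mean_annulus r s) by (auto; intros; apply Hk; lra).
  assert (CC : circle_cont s (fun w => w / (w - z0)))
    by (intros z Hz; apply holo_ccont, Hk; lra).
  rewrite <- (mean_const s 1), <- mean_minus; [|lra|exact CC|apply circle_cont_const].
  rewrite Rmult_assoc. apply mean_bound;
    [lra|apply circle_cont_minus; [exact CC|apply circle_cont_const]|].
  intros t _. set (z := circ s t).
  assert (Hz : Cmod z = s) by (apply Cmod_circ; lra).
  assert (Hn : z - z0 <> 0) by (apply Cmod_lt_neq; lra).
  replace (z / (z - z0) - 1) with (z0 / (z - z0)) by (field; exact Hn).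
  rewrite Cmod_div by exact Hn. unfold Rdiv. apply Rmult_le_compat_l; [assumption|].
  pose proof (Cmod_triangle_rev z z0). rewrite Hz in *.
  rewrite <- (Rinv_inv eps). apply Rinv_le_contravar; [exact He'|].
  unfold s in *. lra.
Qed.

(** With [q] the slope of [f] at [z0], the integrand is [q z * z + f z0 * (z / (z - z0))]. The first
    term is continuous, analytic off [z0] and zero at 0, so its mean vanishes; the kernel has mean
    1. *)
Lemma cauchy_formula (r : R) (z0 : C) (f : C -> C) : (Cmod z0 < r)%R ->
  (forall z, (Cmod z <= r)%R -> holo f z) ->
  mean r (fun z => f z * (z / (z - z0))) = f z0.
Proof.
  intros Hz0 Hf. assert (Hr : (0 < r)%R) by (pose proof (Cmod_ge_0 z0); lra).
  destruct (proj1 (holo_slope f z0) (Hf z0 (Rlt_le _ _ Hz0))) as [q [Hq E]].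
  assert (Hqz : forall z, z <> z0 -> q z = (f z - f z0) / (z - z0)).
  { intros z Hz. rewrite (E z). field. now apply Csub_neq0. }
  assert (Hqh : forall z, (Cmod z <= r)%R -> z <> z0 -> holo q z).
  { intros z Hz Hn. apply (holo_ext_loc (fun w => (f w - f z0) / (w - z0)) _ _ (Cmod (z - z0))).
    - apply Cmod_pos. now apply Csub_neq0.
    - intros w Hw. symmetry. apply Hqz. intros ->. rewrite Cmod_sub_comm in Hw. lra.
    - unfold Cdiv. apply holo_mult.
      + apply holo_minus; [now apply Hf|apply holo_const].
      + apply holo_inv; [now apply Csub_neq0|].
        apply holo_minus; [apply holo_id|apply holo_const]. }
  assert (Hqc : forall z, (Cmod z <= r)%R -> ccont q z).
  { intros z Hz. destruct (Ceq_dec z z0) as [->|Hn]; [exact Hq|].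
    apply holo_ccont. auto. }
  assert (M0 : mean r (fun z => q z * z) = 0).
  { rewrite (mean_value_except r z0 _ Hz0).
    - ring.
    - intros z Hz. apply ccont_mult; [auto|apply ccont_id].
    - intros z Hz Hn _. apply holo_mult; [auto|apply holo_id]. }
  assert (CK : circle_cont r (fun z => z / (z - z0)))
    by (intros z Hz; apply holo_ccont, cauchy_kernel_holo; lra).
  rewrite (mean_ext r _ (fun z => q z * z + f z0 * (z / (z - z0)))); [|lra|].
  - rewrite mean_plus; [|lra| |].
    + rewrite M0, mean_scal, mean_cauchy_kernel; auto; [ring|lra].
    + intros z Hz. apply ccont_mult; [apply Hqc; lra|apply ccont_id].
    + apply circle_cont_mult; [apply circle_cont_const|exact CK].
  - intros z Hz. assert (Hn : z - z0 <> 0) by (apply Cmod_lt_neq; lra).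
    rewrite (E z). field. exact Hn.
Qed.

(** * Taylor series *)

Definition cseries (a : nat -> C) (l : C) : Prop := @is_series C_AbsRing C_NormedModule a l.

Lemma cseries_eps (a : nat -> C) (l : C) :
  cseries a l <-> forall eps, (0 < eps)%R ->
    exists N, forall n, (N <= n)%nat -> (Cmod (sum_n a n - l) < eps)%R.
Proof.
  unfold cseries, is_series. split.
  - intros H eps He.
    destruct (proj1 (filterlim_locally_ball_norm (K := C_AbsRing) (U := C_NormedModule) _ _) H
      (mkposreal eps He)) as [N HN].
    exists N. exact HN.
  - intros H. apply (filterlim_locally_ball_norm (K := C_AbsRing) (U := C_NormedModule)).
    intros eps. destruct (H eps (cond_pos eps)) as [N HN]. exists N. exact HN.
Qed.

Lemma cseries_unique (a : nat -> C) (l l' : C) : cseries a l -> cseries a l' -> l = l'.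
Proof.
  apply (filterlim_locally_unique (K := C_AbsRing) (V := C_NormedModule)).
Qed.

Lemma cseries_ext (a b : nat -> C) (l m : C) :
  (forall k, a k = b k) -> l = m -> cseries a l -> cseries b m.
Proof. intros H <-. now apply (is_series_ext (K := C_AbsRing) (V := C_NormedModule)). Qed.

Lemma cseries_minus (a b : nat -> C) (l m : C) :
  cseries a l -> cseries b m -> cseries (fun k => a k - b k) (l - m).
Proof. apply (is_series_minus (K := C_AbsRing) (V := C_NormedModule)). Qed.

Lemma cseries_scal (c : C) (a : nat -> C) (l : C) :
  cseries a l -> cseries (fun k => c * a k) (c * l).
Proof. apply (is_series_scal (K := C_AbsRing) (V := C_NormedModule)). Qed.

Lemma cseries_shift (a : nat -> C) (l : C) : cseries a l -> cseries (fun k => a (S k)) (l - a O).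
Proof.
  intros H. apply (is_series_incr_1 (K := C_AbsRing) (V := C_NormedModule)).
  change plus with Cplus. now replace (l - a O + a O) with l by ring.
Qed.

Lemma Cmod_sum_n (a : nat -> C) (n : nat) :
  (Cmod (sum_n a n) <= sum_n (fun k => Cmod (a k)) n)%R.
Proof. apply (norm_sum_n_m (K := C_AbsRing) (V := C_NormedModule) a O n). Qed.

Lemma cseries_Cmod_le (a : nat -> C) (b : nat -> R) (l : C) (s : R) :
  (forall k, (Cmod (a k) <= b k)%R) -> cseries a l -> is_series b s -> (Cmod l <= s)%R.
Proof.
  intros Hab Ha Hb.
  apply (filterlim_le (F := eventually) (fun n => norm (sum_n a n)) (sum_n b) (Rbar.Finite (Cmod l))
    (Rbar.Finite s)).
  - exists O. intros n _. eapply Rle_trans; [apply Cmod_sum_n|].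
    apply sum_n_m_le. exact Hab.
  - apply (filterlim_comp _ _ _ _ norm _ (locally l)); [exact Ha|].
    apply (filterlim_norm (K := C_AbsRing) (V := C_NormedModule)).
  - exact Hb.
Qed.

Lemma le_of_le_left (g : R -> R) (x c r : R) : (r < x)%R -> continuous g x ->
  (forall t, (r < t < x)%R -> (g t <= c)%R) -> (g x <= c)%R.
Proof.
  intros Hr Hg H. apply Rnot_lt_le. intros L.
  apply continuity_pt_filterlim in Hg. rewrite continuity_pt_locally in Hg.
  destruct (Hg (mkposreal (g x - c) ltac:(lra))) as [d Hd]. simpl in Hd.
  pose proof (cond_pos d).
  set (t := (x - Rmin d (x - r) / 2)%R).
  assert (0 < Rmin d (x - r))%R by (apply Rmin_glb_lt; lra).
  pose proof (Rmin_l d (x - r)). pose proof (Rmin_r d (x - r)).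
  assert (Ht : (r < t < x)%R) by (unfold t; lra).
  specialize (H t Ht).
  assert (B : (Rabs (g t - g x) < g x - c)%R).
  { apply Hd. unfold ball; simpl. unfold AbsRing_ball, abs, minus, plus, opp; simpl.
    apply Rabs_def1; unfold t; lra. }
  apply Rabs_def2 in B. lra.
Qed.

(** Cauchy's coefficient integral. The radius [1 / 2] is arbitrary in (0, 1), and [taylor_coef_mean]
    exchanges it for any other. *)
Definition taylor_coef (f : C -> C) (k : nat) : C := mean (1 / 2) (fun z => f z / z ^ k).

Lemma holo_div_pow (f : C -> C) (k : nat) (z : C) : z <> 0 -> holo f z ->
  holo (fun w => f w / w ^ k) z.
Proof.
  intros Hz Hf. unfold Cdiv. apply holo_mult; [exact Hf|].
  apply holo_inv; [now apply Cpow_nz|]. apply holo_pow, holo_id.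
Qed.

Section Taylor.

Variables (f : C -> C) (M : R).
Hypothesis f_holo : forall z, disk z -> holo f z.
Hypothesis f_bound : forall z, disk z -> (Cmod (f z) <= M)%R.

Local Lemma taylor_coef_mean (r : R) (k : nat) : (0 < r < 1)%R ->
  taylor_coef f k = mean r (fun z => f z / z ^ k).
Proof.
  intros Hr.
  assert (H : forall r1 r2, (0 < r1)%R -> (r1 <= r2)%R -> (r2 < 1)%R ->
    mean r1 (fun z => f z / z ^ k) = mean r2 (fun z => f z / z ^ k)).
  { intros r1 r2 H1 H2 H3. apply mean_annulus; auto. intros z Hz.
    apply holo_div_pow; [apply neq0_of_Cmod; lra|]. apply f_holo. unfold disk. lra. }
  unfold taylor_coef. destruct (Rle_dec (1 / 2) r); [apply H|symmetry; apply H]; lra.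
Qed.

Local Lemma circle_cont_div_pow (r : R) (k : nat) : (0 < r < 1)%R ->
  circle_cont r (fun z => f z / z ^ k).
Proof.
  intros Hr z Hz. apply holo_ccont, holo_div_pow; [apply neq0_of_Cmod; lra|].
  apply f_holo. unfold disk. lra.
Qed.

(** Cauchy's estimate on radius [r], followed by [r] tending to 1. A fixed radius would give a bound
    growing geometrically in [k]; uniformity in [k] is what later makes subsequences of the
    coefficients converge on the whole disk. *)
Lemma taylor_coef_bound (k : nat) : (Cmod (taylor_coef f k) <= 2 * M)%R.
Proof.
  apply Rle_trans with ((fun r => r ^ k * Cmod (taylor_coef f k))%R 1%R).
  - simpl. rewrite pow1. lra.
  - apply (le_of_le_left (fun r => r ^ k * Cmod (taylor_coef f k))%R 1 _ 0); [lra| |].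
    + apply (ex_derive_continuous (fun r => r ^ k * Cmod (taylor_coef f k))%R). auto_derive. auto.
    + intros r Hr. rewrite (taylor_coef_mean r k Hr).
      pose proof (pow_lt r k ltac:(lra)) as Hp.
      apply Rle_trans with (r ^ k * (2 * (M / r ^ k)))%R; [|right; field; lra].
      apply Rmult_le_compat_l; [lra|].
      apply mean_bound; [lra|now apply circle_cont_div_pow|].
      intros t _. pose proof (Cmod_circ r t ltac:(lra)) as Ht.
      rewrite Cmod_div by (apply Cpow_nz, neq0_of_Cmod; lra).
      rewrite Cmod_pow, Ht. apply Rmult_le_compat_r; [apply Rlt_le, Rinv_0_lt_compat, Hp|].
      apply f_bound. unfold disk. lra.
Qed.

(** The exact remainder of the geometric sum avoids any exchange of a series with the mean. *)
Local Lemma geometric_remainder (z z0 : C) (n : nat) : z <> 0 -> z - z0 <> 0 ->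
  z / (z - z0) = sum_n (fun k => z0 ^ k / z ^ k) n + (z0 / z) ^ S n * (z / (z - z0)).
Proof.
  intros H1 H2. induction n as [|n IH].
  - rewrite sum_O. simpl. field. auto.
  - rewrite sum_Sn. change plus with Cplus. rewrite IH at 1. rewrite <- Cplus_assoc. f_equal.
    rewrite (Cpow_S (z0 / z) (S n)).
    assert (E : (z0 / z) ^ S n = z0 ^ S n / z ^ S n)
      by (unfold Cdiv; rewrite Cpow_mult_l, Cpow_inv; auto).
    rewrite <- E. field. auto.
Qed.

Lemma taylor_series (z0 : C) : disk z0 -> cseries (fun k => taylor_coef f k * z0 ^ k) (f z0).
Proof.
  intros Hz0. unfold disk in Hz0. pose proof (Cmod_ge_0 z0) as Hz0'.
  set (r := ((1 + Cmod z0) / 2)%R).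
  assert (Hr : (0 < r < 1)%R) by (unfold r; lra).
  assert (Hzr : (Cmod z0 < r)%R) by (unfold r; lra). clearbody r.
  set (q := (Cmod z0 / r)%R).
  assert (Hq : (0 <= q < 1)%R).
  { unfold q. split; [apply Rmult_le_pos; [lra|apply Rlt_le, Rinv_0_lt_compat; lra]|].
    apply Rmult_lt_reg_r with r; [lra|]. unfold Rdiv. rewrite Rmult_assoc, Rinv_l; lra. }
  (* The factors are the 2 of [mean_bound], the bound of [f], and the maximum of the Cauchy kernel
     on the circle; the remaining [q ^ S n] gives the decay. *)
  set (B := (2 * (M * (r / (r - Cmod z0))))%R).
  assert (fc : circle_cont r f) by (intros z Hz; apply holo_ccont, f_holo; unfold disk; lra).
  assert (kc : circle_cont r (fun z => z / (z - z0)))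
    by (intros z Hz; apply holo_ccont, cauchy_kernel_holo; lra).
  assert (Rem : forall n, (Cmod (sum_n (fun k => taylor_coef f k * z0 ^ k)%C n - f z0)
    <= B * q ^ S n)%R).
  { intros n. rewrite Cmod_sub_comm.
    assert (E : f z0 - sum_n (fun k => taylor_coef f k * z0 ^ k) n =
      mean r (fun z => f z * ((z0 / z) ^ S n * (z / (z - z0))))).
    { rewrite <- (cauchy_formula r z0 f Hzr) by (intros; apply f_holo; unfold disk; lra).
      rewrite (sum_n_ext _ (fun k => mean r (fun z => z0 ^ k * (f z / z ^ k)))).
      - rewrite <- (mean_sum_n r (fun k z => z0 ^ k * (f z / z ^ k))), <- mean_minus.
        + apply mean_ext; [lra|]. intros z Hz.
          rewrite (geometric_remainder z z0 n) at 1
            by first [apply neq0_of_Cmod; lra|apply Cmod_lt_neq; lra].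
          rewrite (sum_n_ext (fun k => z0 ^ k * (f z / z ^ k)) (fun k => f z * (z0 ^ k / z ^ k)))
            by (unfold Cdiv; cring).
          rewrite Csum_scal. ring.
        + lra.
        + now apply circle_cont_mult.
        + intros z Hz. apply ccont_sum_n. intros k _.
          apply (ccont_mult (fun _ => z0 ^ k) (fun z => f z / z ^ k)); [apply ccont_const|].
          now apply (circle_cont_div_pow r).
        + lra.
        + intros k _. apply circle_cont_mult; [apply circle_cont_const|].
          now apply circle_cont_div_pow.
      - intros k. rewrite mean_scal; [|lra|now apply circle_cont_div_pow].
        rewrite <- taylor_coef_mean by exact Hr. cring. }
    rewrite E. unfold B. rewrite Rmult_assoc. apply mean_bound; [lra| |].
    - apply circle_cont_mult; [exact fc|]. apply circle_cont_mult; [|exact kc].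
      intros z Hz. apply ccont_pow. unfold Cdiv. apply ccont_mult; [apply ccont_const|].
      apply ccont_inv; [apply neq0_of_Cmod; lra|apply ccont_id].
    - intros t _. set (z := circ r t).
      assert (Hz : Cmod z = r) by (apply Cmod_circ; lra).
      rewrite !Cmod_mult, Cmod_pow, !Cmod_div, Hz
        by first [apply neq0_of_Cmod; lra|apply Cmod_lt_neq; lra].
      fold q. pose proof (pow_le q (S n) ltac:(lra)) as Hqp.
      pose proof (Cmod_triangle_rev z z0) as T. rewrite Hz in T.
      assert (A1 : (Cmod (f z) <= M)%R) by (apply f_bound; unfold disk; lra).
      assert (A2 : (r / Cmod (z - z0) <= r / (r - Cmod z0))%R)
        by (apply Rmult_le_compat_l; [lra|apply Rinv_le_contravar; lra]).
      assert (A3 : (0 <= r / Cmod (z - z0))%R)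
        by (apply Rmult_le_pos; [lra|apply Rlt_le, Rinv_0_lt_compat; lra]).
      rewrite Rmult_assoc, (Rmult_comm _ (q ^ S n)).
      apply Rmult_le_compat; [apply Cmod_ge_0|now apply Rmult_le_pos|exact A1|].
      now apply Rmult_le_compat_l. }
  apply cseries_eps. intros eps He.
  assert (HB : (0 < Rabs B + 1)%R) by (pose proof (Rabs_pos B); lra).
  destruct (pow_lt_1_zero q ltac:(rewrite Rabs_pos_eq; lra) (eps / (Rabs B + 1))%R
    ltac:(now apply Rdiv_lt_0_compat)) as [N HN].
  exists N. intros n Hn. specialize (HN (S n) ltac:(lia)).
  rewrite Rabs_pos_eq in HN by (apply pow_le; lra).
  eapply Rle_lt_trans; [apply Rem|].
  apply Rle_lt_trans with ((Rabs B + 1) * q ^ S n)%R.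
  - apply Rmult_le_compat_r; [apply pow_le; lra|]. pose proof (Rle_abs B); lra.
  - apply (Rmult_lt_compat_l (Rabs B + 1)) in HN; [|exact HB].
    replace ((Rabs B + 1) * (eps / (Rabs B + 1)))%R with eps in HN by (field; lra). exact HN.
Qed.

End Taylor.

(** * Differentiation of power series *)

(** Phrased through the real series of moduli, so that invariance of the real radius of convergence
    under differentiation carries over to complex coefficients. *)
Definition disk_coefs (a : nat -> C) : Prop :=
  Rbar_le (Rbar.Finite 1) (CV_radius (fun k => Cmod (a k))).

Definition derive_coefs (a : nat -> C) (k : nat) : C := INR (S k) * a (S k).

Lemma bounded_disk_coefs (a : nat -> C) (M : R) :
  (forall k, (Cmod (a k) <= M)%R) -> disk_coefs a.
Proof.
  intros H. apply (CV_radius_bounded (fun k => Cmod (a k))). exists M. intros n.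
  rewrite pow1, Rmult_1_r, Rabs_pos_eq by apply Cmod_ge_0. apply H.
Qed.

Lemma Cmod_derive_coefs (a : nat -> C) (k : nat) :
  Cmod (derive_coefs a k) = PS_derive (fun k => Cmod (a k)) k.
Proof.
  unfold derive_coefs, PS_derive. rewrite Cmod_mult, Cmod_R, Rabs_pos_eq; [reflexivity|].
  apply pos_INR.
Qed.

Lemma derive_disk_coefs (a : nat -> C) : disk_coefs a -> disk_coefs (derive_coefs a).
Proof.
  unfold disk_coefs. intros H.
  rewrite (CV_radius_ext _ _ (Cmod_derive_coefs a)). now rewrite CV_radius_derive.
Qed.

Lemma disk_coefs_ex_series (a : nat -> C) (r : R) : disk_coefs a -> (0 <= r < 1)%R ->
  ex_series (fun k => Cmod (a k) * r ^ k)%R.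
Proof.
  intros Ha Hr.
  apply (ex_series_ext (fun k => Rabs (Cmod (a k) * r ^ k))).
  - intros k. apply Rabs_pos_eq, Rmult_le_pos; [apply Cmod_ge_0|apply pow_le; lra].
  - apply CV_disk_inside. eapply Rbar_lt_le_trans; [|exact Ha]. simpl.
    rewrite Rabs_pos_eq; lra.
Qed.

Lemma disk_coefs_sum (a : nat -> C) (z : C) : disk_coefs a -> disk z ->
  exists l, cseries (fun k => a k * z ^ k) l.
Proof.
  intros Ha Hz.
  apply (ex_series_le (K := C_AbsRing) (V := C_CompleteNormedModule) _
    (fun k => Cmod (a k) * Cmod z ^ k)%R).
  - intros k. change norm with Cmod. rewrite Cmod_mult, Cmod_pow. lra.
  - apply disk_coefs_ex_series; [exact Ha|]. split; [apply Cmod_ge_0|exact Hz].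
Qed.

(** The induction rests on [e (S k) = w * e k + INR (S (S k)) * z ^ S k * (w - z) ^ 2]. The constant
    is twice the sharp one, and it is exactly the factor produced by differentiating a power series
    twice. *)
Lemma pow_taylor2_bound (z w : C) (r : R) (k : nat) : (Cmod z <= r)%R -> (Cmod w <= r)%R ->
  (Cmod (w ^ S (S k) - z ^ S (S k) - INR (S (S k)) * z ^ S k * (w - z)) <=
    INR (S (S k)) * INR (S k) * r ^ k * Cmod (w - z) ^ 2)%R.
Proof.
  intros Hz Hw. pose proof (Cmod_ge_0 z).
  set (e := fun k : nat => w ^ S (S k) - z ^ S (S k) - INR (S (S k)) * z ^ S k * (w - z)).
  change (Cmod (e k) <= INR (S (S k)) * INR (S k) * r ^ k * Cmod (w - z) ^ 2)%R.
  induction k as [|k IH].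
  - replace (e O) with ((w - z) ^ 2)
      by (unfold e; rewrite !S_INR, !RtoC_plus; simpl; ring).
    rewrite Cmod_pow, !S_INR. simpl. pose proof (pow2_ge_0 (Cmod (w - z))). simpl in *. lra.
  - replace (e (S k)) with (w * e k + INR (S (S k)) * z ^ S k * (w - z) ^ 2)
      by (unfold e; rewrite !S_INR, !RtoC_plus, !(Cpow_S _ (S _)); ring).
    eapply Rle_trans; [apply Cmod_triangle|].
    rewrite !Cmod_mult, !Cmod_pow, Cmod_R, (Rabs_pos_eq (INR _)) by apply pos_INR.
    set (d := (Cmod (w - z) ^ 2)%R) in *.
    assert (Hd : (0 <= d)%R) by apply pow2_ge_0.
    assert (Hp : (Cmod z ^ S k <= r ^ S k)%R) by (apply pow_incr; lra).
    pose proof (pow_le r k ltac:(lra)) as Hrk. pose proof (pos_INR k) as Hk.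
    pose proof (pos_INR (S (S k))) as HSk.
    assert (A : (Cmod w * Cmod (e k) <= r * (INR (S (S k)) * INR (S k) * r ^ k * d))%R)
      by (apply Rmult_le_compat; auto using Cmod_ge_0).
    assert (B : (INR (S (S k)) * Cmod z ^ S k * d <= INR (S (S k)) * r ^ S k * d)%R)
      by (apply Rmult_le_compat_r; [exact Hd|now apply Rmult_le_compat_l]).
    eapply Rle_trans; [apply Rplus_le_compat; [exact A|exact B]|].
    replace (r * (INR (S (S k)) * INR (S k) * r ^ k * d) + INR (S (S k)) * r ^ S k * d)%R
      with (INR (S (S k)) * (INR (S k) + 1) * (r ^ S k * d))%R by (simpl pow; ring).
    replace (INR (S (S (S k))) * INR (S (S k)) * r ^ S k * d)%R
      with (INR (S (S k)) * INR (S (S (S k))) * (r ^ S k * d))%R by ring.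
    assert (Hrd : (0 <= r ^ S k * d)%R)
      by (apply Rmult_le_pos; [apply pow_le; lra|exact Hd]).
    apply Rmult_le_compat_r; [exact Hrd|]. apply Rmult_le_compat_l; [exact HSk|].
    rewrite !S_INR. lra.
Qed.

Lemma cseries_at_0 (a : nat -> C) : cseries (fun k => a k * 0 ^ k) (a O).
Proof.
  apply cseries_eps. intros eps He. exists O. intros n _.
  replace (sum_n (fun k => a k * 0 ^ k) n) with (a O).
  - replace (a O - a O) with (RtoC 0) by ring. now rewrite Cmod_0.
  - induction n as [|n IH]; [rewrite sum_O; simpl; cring|].
    rewrite sum_Sn, <- IH. change plus with Cplus. simpl. cring.
Qed.

(** Summing the second-order bounds of the powers gives an error of at most [s * Cmod (w - z) ^ 2],
    where [s] is the twice differentiated series of moduli at a radius [r] between [Cmod z] and 1.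
    Terms 0 and 1 cancel, which is why the series of [f] are shifted twice and that of [l] once. *)
Lemma cseries_cderiv (a : nat -> C) (f : C -> C) (z l : C) : disk_coefs a ->
  (forall w, disk w -> cseries (fun k => a k * w ^ k) (f w)) -> disk z ->
  cseries (fun k => derive_coefs a k * z ^ k) l -> cderiv f z l.
Proof.
  intros Ha Hf Hz Hl. unfold disk in Hz. pose proof (Cmod_ge_0 z).
  set (r := ((1 + Cmod z) / 2)%R). assert (Hr : (Cmod z < r < 1)%R) by (unfold r; lra).
  clearbody r.
  destruct (disk_coefs_ex_series _ r (derive_disk_coefs _ (derive_disk_coefs _ Ha)) ltac:(lra))
    as [s Hs].
  assert (Hs0 : (0 <= s)%R).
  { rewrite <- Cmod_0. eapply (cseries_Cmod_le (fun _ => 0)); [|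
      |exact Hs].
    - intros k. cbv beta. rewrite Cmod_0. apply Rmult_le_pos; [apply Cmod_ge_0|apply pow_le; lra].
    - apply (cseries_ext (fun k => 0 * 0 ^ k) _ 0); [intros k; ring|reflexivity|].
      apply (cseries_at_0 (fun _ => 0)). }
  intros eps He.
  exists (Rmin (r - Cmod z) (eps / (s + 1)))%R. split.
  { apply Rmin_glb_lt; [lra|apply Rdiv_lt_0_compat; lra]. }
  intros w Hw.
  pose proof (Rmin_l (r - Cmod z) (eps / (s + 1))) as R1.
  pose proof (Rmin_r (r - Cmod z) (eps / (s + 1))) as R2.
  assert (Hwr : (Cmod w <= r)%R).
  { pose proof (Cmod_triangle_rev w z). lra. }
  assert (D : cseries (fun k => a (S (S k)) *
      (w ^ S (S k) - z ^ S (S k) - INR (S (S k)) * z ^ S k * (w - z))) (f w - f z - l * (w - z))).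
  { assert (Hw1 : disk w) by (unfold disk; lra).
    pose proof (cseries_shift _ _ (cseries_shift _ _ (Hf w Hw1))) as S1.
    pose proof (cseries_shift _ _ (cseries_shift _ _ (Hf z Hz))) as S2.
    pose proof (cseries_scal (w - z) _ _ (cseries_shift _ _ Hl)) as S3.
    pose proof (cseries_minus _ _ _ _ (cseries_minus _ _ _ _ S1 S2) S3) as S4.
    eapply cseries_ext; [| |exact S4].
    - intros k. unfold derive_coefs. cbv beta. ring.
    - unfold derive_coefs. simpl. ring. }
  assert (Bd : (Cmod (f w - f z - l * (w - z)) <= s * Cmod (w - z) ^ 2)%R).
  { eapply cseries_Cmod_le; [|exact D|apply is_series_scal_r, Hs].
    intros k. cbv beta. rewrite Cmod_mult, !Cmod_derive_coefs. unfold PS_derive.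
    rewrite Cmod_derive_coefs. unfold PS_derive.
    eapply Rle_trans; [apply Rmult_le_compat_l; [apply Cmod_ge_0|];
      apply (pow_taylor2_bound z w r k); lra|].
    right. ring. }
  eapply Rle_trans; [exact Bd|]. simpl. rewrite Rmult_1_r, <- Rmult_assoc.
  apply Rmult_le_compat_r; [apply Cmod_ge_0|].
  apply Rle_trans with ((s + 1) * (eps / (s + 1)))%R; [|right; field; lra].
  apply Rmult_le_compat; try lra. apply Cmod_ge_0.
Qed.

Lemma cseries_holo (a : nat -> C) (f : C -> C) (z : C) : disk_coefs a ->
  (forall w, disk w -> cseries (fun k => a k * w ^ k) (f w)) -> disk z -> holo f z.
Proof.
  intros Ha Hf Hz. destruct (disk_coefs_sum _ z (derive_disk_coefs _ Ha) Hz) as [l Hl].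
  exists l. now apply (cseries_cderiv a).
Qed.

(** The [k] times derived series represents [C_derive_n f k] on the whole disk, and its constant
    term is [a k] times k!. That factor is kept as an unspecified positive [c], since only its being
    nonzero matters. *)
Lemma taylor_coef_eq0 (a : nat -> C) (f : C -> C) (k : nat) : disk_coefs a ->
  (forall w, disk w -> cseries (fun k => a k * w ^ k) (f w)) ->
  C_derive_n f k 0 = 0 -> a k = 0.
Proof.
  intros Ha Hf Hk.
  set (b := Nat.iter k derive_coefs a).
  assert (K : disk_coefs b /\
    forall w, disk w -> cseries (fun j => b j * w ^ j) (C_derive_n f k w)).
  { unfold b. clear b Hk. induction k as [|k [IH1 IH2]]; [now split|].
    simpl. split; [now apply derive_disk_coefs|]. intros w Hw.
    destruct (disk_coefs_sum _ w (derive_disk_coefs _ IH1) Hw) as [l Hl].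
    rewrite (is_C_derive_unique (C_derive_n f k) w l); [exact Hl|].
    apply is_derive_cderiv. now apply (cseries_cderiv (Nat.iter k derive_coefs a)). }
  assert (E : forall j, exists c, (0 < c)%R /\ b j = c * a (k + j)%nat).
  { unfold b. clear. induction k as [|k IH]; intros j.
    - exists 1%R. split; [lra|]. simpl. ring.
    - destruct (IH (S j)) as [c [Hc E]]. exists (INR (S j) * c)%R. split.
      + apply Rmult_lt_0_compat; [apply lt_0_INR; lia|exact Hc].
      + simpl Nat.iter. unfold derive_coefs at 1. rewrite E.
        replace (k + S j)%nat with (S k + j)%nat by lia.
        rewrite RtoC_mult. ring. }
  destruct (E O) as [c [Hc Ec]]. rewrite Nat.add_0_r in Ec.
  assert (B0 : b O = 0).
  { rewrite <- Hk. apply (cseries_unique (fun j => b j * 0 ^ j)); [apply cseries_at_0|].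
    apply K. unfold disk. rewrite Cmod_0. lra. }
  assert (Hc' : RtoC c <> 0) by (apply neq0_of_Cmod; rewrite Cmod_R, Rabs_pos_eq; lra).
  replace (a k) with (/ c * (c * a k)) by (field; exact Hc').
  rewrite <- Ec, B0. ring.
Qed.

(** Partial sums of the full series are constant between consecutive multiples of [d], so those of
    the thinned series form a subsequence of them. *)
Lemma cseries_stride (a : nat -> C) (d : nat) (z l : C) : (0 < d)%nat ->
  (forall k, ~ Nat.divide d k -> a k = 0) -> cseries (fun k => a k * z ^ k) l ->
  cseries (fun j => a (d * j)%nat * (z ^ d) ^ j) l.
Proof.
  intros Hd Ha H. apply cseries_eps. intros eps He.
  destruct (proj1 (cseries_eps _ _) H eps He) as [N HN]. exists N. intros n Hn.
  replace (sum_n (fun j => a (d * j)%nat * (z ^ d) ^ j) n)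
    with (sum_n (fun k => a k * z ^ k) (d * n)); [apply HN; nia|].
  clear - Hd Ha. induction n as [|n IH].
  - rewrite Nat.mul_0_r, !sum_O, Nat.mul_0_r. simpl. cring.
  - rewrite sum_Sn, <- IH. change plus with Cplus.
    replace (d * S n)%nat with (d * n + d)%nat by lia.
    assert (G : forall i, (i < d)%nat ->
      sum_n (fun k => a k * z ^ k) (d * n + i) = sum_n (fun k => a k * z ^ k) (d * n)).
    { induction i as [|i IHi]; intros Hi; [now rewrite Nat.add_0_r|].
      rewrite Nat.add_succ_r, sum_Sn, IHi by lia. change plus with Cplus.
      rewrite (Ha (S (d * n + i))).
      - cring.
      - intros [q Hq]. destruct (Nat.le_gt_cases q n) as [K|K];
          [pose proof (Nat.mul_le_mono_r _ _ d K)|pose proof (Nat.mul_le_mono_r (S n) q d K)];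
          simpl in *; lia. }
    replace (d * n + d)%nat with (S (d * n + (d - 1))) by lia.
    rewrite sum_Sn, G by lia. change plus with Cplus.
    replace (S (d * n + (d - 1))) with (d * S n)%nat by lia.
    now rewrite Cpow_mult_r.
Qed.

(** [g] has the coefficients of [f] at the multiples of [d], and [h] has those of [g] from index [m]
    on. Both sequences inherit the uniform bound, hence analyticity on the disk, including at 0,
    where a d-th root would not be analytic for [d > 1]. *)
Lemma sparse_taylor (f : C -> C) (d m : nat) (M : R) : (0 < d)%nat -> (0 < m)%nat ->
  (forall z, disk z -> holo f z) -> (forall z, disk z -> (Cmod (f z) <= M)%R) ->
  (forall k, (0 < k)%nat -> ~ Nat.divide d k \/ (k < d * m)%nat -> C_derive_n f k 0 = 0) ->
  exists g h : C -> C, (forall s, disk s -> holo g s) /\ (forall s, disk s -> holo h s) /\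
    (forall z, disk z -> f z = g (z ^ d)) /\
    (forall s, disk s -> g s = f 0 + s ^ m * h s).
Proof.
  intros Hd Hm Hf HM Hk. set (a := taylor_coef f).
  assert (Ha : forall k, (Cmod (a k) <= 2 * M)%R) by (intros k; now apply taylor_coef_bound).
  pose proof (bounded_disk_coefs _ _ Ha) as Ha'.
  assert (Hfa : forall z, disk z -> cseries (fun k => a k * z ^ k) (f z))
    by (intros z Hz; now apply (taylor_series f M)).
  assert (Z : forall k, (0 < k)%nat -> ~ Nat.divide d k \/ (k < d * m)%nat -> a k = 0).
  { intros k K1 K2. apply (taylor_coef_eq0 a f k Ha' Hfa). auto. }
  assert (Sum : forall b : nat -> C, disk_coefs b ->
    exists g, forall s, disk s -> cseries (fun k => b k * s ^ k) (g s)).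
  { intros b Hb. apply (functional_choice (fun s l => disk s -> cseries (fun k => b k * s ^ k) l)).
    intros s. destruct (classic (disk s)) as [Hs|Hs].
    - destruct (disk_coefs_sum b s Hb Hs) as [l Hl]. now exists l.
    - exists 0. now intros. }
  set (b := fun j => a (d * j)%nat). set (c := fun j => b (m + j)%nat).
  assert (Hb : disk_coefs b) by (apply (bounded_disk_coefs _ (2 * M)); intros; apply Ha).
  assert (Hc : disk_coefs c) by (apply (bounded_disk_coefs _ (2 * M)); intros; apply Ha).
  destruct (Sum b Hb) as [g Hg]. destruct (Sum c Hc) as [h Hh].
  exists g, h. split; [|split; [|split]].
  - intros s Hs. now apply (cseries_holo b).
  - intros s Hs. now apply (cseries_holo c).
  - intros z Hz. apply (cseries_unique (fun j => b j * (z ^ d) ^ j)).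
    + apply (cseries_stride a d z (f z) Hd); [|now apply Hfa].
      intros k K. apply Z; [|now left]. destruct k; [|lia]. exfalso. apply K. now exists O.
    + apply Hg. unfold disk in *. rewrite Cmod_pow.
      pose proof (Cmod_ge_0 z). destruct d as [|d]; [lia|]. simpl.
      assert (Cmod z ^ d <= 1)%R by (rewrite <- (pow1 d); apply pow_incr; lra).
      pose proof (pow_le (Cmod z) d ltac:(lra)). nra.
  - intros s Hs.
    assert (E0 : b O = f 0).
    { unfold b. rewrite Nat.mul_0_r.
      apply (cseries_unique (fun k => a k * 0 ^ k)); [apply cseries_at_0|].
      apply Hfa. unfold disk. rewrite Cmod_0. lra. }
    assert (P : forall n, (n < m)%nat -> sum_n (fun j => b j * s ^ j) n = b O).
    { induction n as [|n IH]; intros Hn; [rewrite sum_O; simpl; cring|].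
      rewrite sum_Sn, IH by lia. change plus with Cplus.
      unfold b at 2. rewrite Z; [cring|nia|right; nia]. }
    assert (T : cseries (fun j => b (m + j)%nat * s ^ (m + j)) (g s - b O)).
    { apply (is_series_incr_n (K := C_AbsRing) (V := C_NormedModule) (fun j => b j * s ^ j) m);
        [exact Hm|].
      change plus with Cplus. rewrite P by lia.
      replace (g s - b O + b O) with (g s) by ring. now apply Hg. }
    assert (U : cseries (fun j => b (m + j)%nat * s ^ (m + j)) (s ^ m * h s)).
    { eapply cseries_ext; [|reflexivity|apply cseries_scal, Hh, Hs].
      intros j. unfold c. cbv beta. rewrite Cpow_add_r. ring. }
    rewrite <- (cseries_unique _ _ _ T U), E0. ring.
Qed.

(** * Pick's necessary condition *)

Lemma Csum_conj (a : nat -> C) (n : nat) : Cconj (sum_n a n) = sum_n (fun k => Cconj (a k)) n.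
Proof.
  induction n as [|n IH]; [now rewrite !sum_O|].
  rewrite !sum_Sn, <- IH. apply Cplus_conj.
Qed.

Lemma mean_conj (r : R) (F : C -> C) : (0 <= r)%R -> circle_cont r F ->
  mean r (fun z => Cconj (F z)) = Cconj (mean r F).
Proof.
  intros Hr HF. destruct (circle_cont_ex_RInt r F Hr HF) as [_ F2].
  unfold mean, Cconj; simpl. f_equal.
  pose proof (RInt_opp (V := R_CompleteNormedModule) _ _ _ F2) as E.
  unfold opp in E; simpl in E. unfold Rdiv. rewrite Ropp_mult_distr_l, <- E. reflexivity.
Qed.

Lemma Cmod_lt_neq1 (x : C) : (Cmod x < 1)%R -> 1 - x <> 0.
Proof. intros H. apply Cmod_lt_neq. now rewrite Cmod_1. Qed.

Section PickCircle.

Variables (r B : R) (g : C -> C) (n : nat) (x c : nat -> C).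
Hypothesis r_pos : (0 < r)%R.
Hypothesis B_pos : (0 < B)%R.
Hypothesis g_holo : forall z, (Cmod z <= r)%R -> holo g z.
Hypothesis g_bound : forall z, Cmod z = r -> (Cmod (g z) <= B)%R.
Hypothesis x_small : forall i, (i <= n)%nat -> (Cmod (x i) < r)%R.

Let t : C := RtoC (/ (r * r)).

(* Szego kernel of the disk of radius [r]. *)
Let kernel (j : nat) (s : C) : C := / (1 - s * Cconj (x j) * t).

Local Lemma kernel_den (j : nat) (s : C) : (j <= n)%nat -> (Cmod s <= r)%R ->
  1 - s * Cconj (x j) * t <> 0.
Proof.
  intros Hj Hs. apply Cmod_lt_neq1. unfold t.
  rewrite !Cmod_mult, Cmod_conj, Cmod_R.
  assert (Hp := Rinv_0_lt_compat (r * r) ltac:(nra)). rewrite Rabs_pos_eq by lra.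
  pose proof (x_small j Hj) as Hxj. pose proof (Cmod_ge_0 (x j)). pose proof (Cmod_ge_0 s).
  apply Rlt_le_trans with (r * r * / (r * r))%R; [|right; field; lra].
  apply Rmult_lt_compat_r; [exact Hp|].
  apply Rle_lt_trans with (r * Cmod (x j))%R; [apply Rmult_le_compat_r; lra|nra].
Qed.

Local Lemma kernel_holo (j : nat) (s : C) : (j <= n)%nat -> (Cmod s <= r)%R ->
  holo (kernel j) s.
Proof.
  intros Hj Hs. unfold kernel. apply holo_inv; [now apply kernel_den|].
  apply holo_minus; [apply holo_const|].
  apply holo_mult; [apply holo_mult|]; auto using holo_const, holo_id.
Qed.

(** On the circle [Cconj s] is [r * r / s], which turns the conjugated Szego kernel into the Cauchy
    kernel; pairing with [kernel j] thereby becomes evaluation at [x j]. *)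
Local Lemma kernel_conj (j : nat) (s : C) : (j <= n)%nat -> Cmod s = r ->
  Cconj (kernel j s) = s / (s - x j).
Proof.
  intros Hj Hs. pose proof (x_small j Hj) as Hxj.
  assert (Hn : s <> 0) by (apply neq0_of_Cmod; lra).
  assert (Hd : s - x j <> 0) by (apply Cmod_lt_neq; lra).
  assert (E : s * Cconj s * t = 1).
  { rewrite <- Cmod2_conj, Hs. unfold t. rewrite <- RtoC_mult. f_equal. field. lra. }
  assert (Et : Cconj t = t)
    by (unfold t, RtoC, Cconj; simpl; f_equal; ring).
  assert (Hk : Cconj (1 - s * Cconj (x j) * t) = (s - x j) / s).
  { rewrite Cminus_conj, !Cmult_conj, Cconj_conj, Et.
    replace (Cconj 1) with (RtoC 1) by (unfold RtoC, Cconj; simpl; f_equal; ring).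
    replace (1 - Cconj s * x j * t) with ((s - x j * (s * Cconj s * t)) / s)
      by (field; exact Hn).
    rewrite E. f_equal. ring. }
  unfold kernel. rewrite Cinv_conj by (apply kernel_den; [exact Hj|lra]).
  rewrite Hk. field. auto.
Qed.

Let comb (d : nat -> C) (s : C) : C := sum_n (fun j => d j * kernel j s) n.

Local Lemma comb_holo (d : nat -> C) (s : C) : (Cmod s <= r)%R -> holo (comb d) s.
Proof.
  intros Hs. apply (holo_sum_n (fun j s => d j * kernel j s)). intros j Hj.
  apply (holo_mult (fun _ => d j) (kernel j)); [apply holo_const|now apply kernel_holo].
Qed.

Local Lemma mean_comb (h : C -> C) (d : nat -> C) :
  (forall z, (Cmod z <= r)%R -> holo h z) ->
  mean r (fun s => h s * Cconj (comb d s)) = sum_n (fun j => Cconj (d j) * h (x j)) n.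
Proof.
  intros Hh.
  assert (hc : circle_cont r h) by (intros z Hz; apply holo_ccont, Hh; lra).
  assert (kc : forall j, (j <= n)%nat -> circle_cont r (fun s => s / (s - x j))).
  { intros j Hj z Hz. pose proof (x_small j Hj) as Hxj. apply holo_ccont, cauchy_kernel_holo. lra. }
  assert (K : forall j, (j <= n)%nat -> circle_cont r (fun s => h s * (s / (s - x j))))
    by (intros j Hj; apply circle_cont_mult; auto).
  transitivity (sum_n (fun j => mean r (fun s => Cconj (d j) * (h s * (s / (s - x j))))) n).
  - rewrite <- (mean_sum_n r (fun j s => Cconj (d j) * (h s * (s / (s - x j))))); [|lra|].
    + apply mean_ext; [lra|]. intros s Hs. unfold comb. rewrite Csum_conj.
      rewrite <- Csum_scal. apply sum_n_ext_loc. intros j Hj.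
      rewrite Cmult_conj, (kernel_conj j s Hj Hs). cring.
    + intros j Hj. apply circle_cont_mult; [apply circle_cont_const|auto].
  - apply sum_n_ext_loc. intros j Hj.
    rewrite mean_scal; [|lra|auto]. rewrite cauchy_formula; auto.
Qed.

Lemma pick_circle :
  let q := sum_n (fun i => sum_n (fun j =>
    Cconj (c i) * ((RtoC (B * B) - g (x i) * Cconj (g (x j))) /
      (1 - x i * Cconj (x j) * t)) * c j) n) n in
  Im q = 0%R /\ (0 <= Re q)%R.
Proof.
  (* [v] is the image of [u] under the adjoint of multiplication by [g]: each kernel is an
     eigenvector of that adjoint, with eigenvalue [Cconj (g (x j))]. This is the source of [X = V]
     below. *)
  set (e := fun j => c j * Cconj (g (x j))). set (u := comb c). set (v := comb e).
  assert (gc : circle_cont r g) by (intros z Hz; apply holo_ccont, g_holo; lra).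
  assert (uc : circle_cont r u) by (intros z Hz; apply holo_ccont, comb_holo; lra).
  assert (vc : circle_cont r v) by (intros z Hz; apply holo_ccont, comb_holo; lra).
  set (U := mean r (fun s => u s * Cconj (u s))).
  set (V := mean r (fun s => v s * Cconj (v s))).
  set (X := mean r (fun s => g s * v s * Cconj (u s))).
  assert (HU : U = sum_n (fun i => Cconj (c i) * u (x i)) n)
    by (apply mean_comb, comb_holo).
  assert (HV : V = sum_n (fun i => Cconj (e i) * v (x i)) n)
    by (apply mean_comb, comb_holo).
  assert (HX : X = sum_n (fun i => Cconj (c i) * (g (x i) * v (x i))) n).
  { apply (mean_comb (fun s => g s * v s)). intros z Hz.
    apply holo_mult; [now apply g_holo|now apply comb_holo]. }
  assert (HXV : X = V).
  { rewrite HX, HV. apply sum_n_ext. intros i. unfold e.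
    rewrite Cmult_conj, Cconj_conj. cring. }
  assert (Vreal : Cconj V = V).
  { destruct (mean_nonneg r (fun s => v s * Cconj (v s))) as [_ I]; [lra| | |].
    - apply circle_cont_mult; [exact vc|now apply circle_cont_conj].
    - intros z _. rewrite <- Cmod2_conj. simpl. split; [apply pow2_ge_0|reflexivity].
    - fold V in I. destruct V as [p q]. unfold Cconj; simpl in *. rewrite I. f_equal. ring. }
  intros q.
  assert (Hq : q = RtoC (B * B) * U - V).
  { rewrite HU, HV. unfold q.
    rewrite <- Csum_scal, <- Csum_minus. apply sum_n_ext_loc. intros i Hi.
    unfold u, v, comb. rewrite <- !Csum_scal, <- Csum_minus. apply sum_n_ext_loc. intros j Hj.
    unfold e, kernel, Cdiv. rewrite Cmult_conj, Cconj_conj. cring. }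
  (* Both summands are nonnegative on the circle, and the second cancels the term |g|^2 |v|^2 of the
     expanded square. What is left is B^2 (B^2 |u|^2 + |v|^2 - 2 Re (g v conj u)); since [X = V] is
     real, its mean is [B * B] times [B * B * U - V]. *)
  set (Phi := fun s => (g s * v s - RtoC (B * B) * u s) * Cconj (g s * v s - RtoC (B * B) * u s)
    + (RtoC (B * B) - g s * Cconj (g s)) * (v s * Cconj (v s))).
  assert (P : (0 <= Re (mean r Phi))%R /\ Im (mean r Phi) = 0%R).
  { apply mean_nonneg; [lra| |].
    - assert (A : circle_cont r (fun s => g s * v s - RtoC (B * B) * u s))
        by (apply circle_cont_minus; apply circle_cont_mult; auto using circle_cont_const).
      apply circle_cont_plus; apply circle_cont_mult; auto using circle_cont_conj.
      + apply circle_cont_minus; [apply circle_cont_const|].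
        apply circle_cont_mult; auto using circle_cont_conj.
      + apply circle_cont_mult; auto using circle_cont_conj.
    - intros s Hs. unfold Phi. rewrite <- !Cmod2_conj.
      rewrite <- RtoC_minus, <- RtoC_mult, <- RtoC_plus. simpl.
      split; [|reflexivity]. pose proof (g_bound s Hs) as Hgs. pose proof (Cmod_ge_0 (g s)).
      assert (0 <= B * B - Cmod (g s) * (Cmod (g s) * 1))%R by nra.
      apply Rplus_le_le_0_compat; [apply pow2_ge_0|].
      apply Rmult_le_pos; [assumption|apply pow2_ge_0]. }
  assert (HPhi : mean r Phi = RtoC (B * B) * q).
  { assert (Xc : circle_cont r (fun s => g s * v s * Cconj (u s)))
      by (repeat apply circle_cont_mult; auto using circle_cont_conj).
    assert (Uc : circle_cont r (fun s => u s * Cconj (u s)))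
      by (repeat apply circle_cont_mult; auto using circle_cont_conj).
    assert (Vc : circle_cont r (fun s => v s * Cconj (v s)))
      by (repeat apply circle_cont_mult; auto using circle_cont_conj).
    pose proof (circle_cont_conj _ _ Xc) as Xc'.
    set (b := RtoC (B * B)).
    assert (Hb : Cconj b = b) by (unfold b, RtoC, Cconj; simpl; f_equal; ring).
    rewrite (mean_ext r Phi (fun s => b * (b * (u s * Cconj (u s)) + v s * Cconj (v s)
      - (g s * v s * Cconj (u s) + Cconj (g s * v s * Cconj (u s)))))); [|lra|].
    - rewrite mean_scal, mean_minus, !mean_plus, mean_conj, mean_scal;
        auto using circle_cont_minus, circle_cont_plus, circle_cont_mult, circle_cont_const;
        try lra.
      fold U V X. rewrite HXV, Vreal, Hq. fold b. ring.
    - intros s _. unfold Phi. fold b.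
      rewrite Cminus_conj, !Cmult_conj, Cconj_conj, Hb. ring. }
  rewrite HPhi in P. destruct P as [P1 P2].
  assert (E : forall a, Re (RtoC (B * B) * a) = (B * B * Re a)%R /\
    Im (RtoC (B * B) * a) = (B * B * Im a)%R)
    by (intros [a1 a2]; simpl; split; ring).
  destruct (E q) as [E1 E2]. rewrite E1 in P1. rewrite E2 in P2.
  assert (HBB : (0 < B * B)%R) by now apply Rmult_lt_0_compat.
  split.
  - apply Rmult_integral in P2. destruct P2; lra.
  - apply Rmult_le_reg_l with (B * B)%R; [exact HBB|]. lra.
Qed.

End PickCircle.

Lemma continuous_ccont_comp (Q : C -> C) (p : R -> R) (y : R) :
  ccont Q (RtoC (p y)) -> continuous p y ->
  continuous (fun r => Re (Q (RtoC (p r)))) y /\ continuous (fun r => Im (Q (RtoC (p r)))) y.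
Proof.
  intros HQ Hp. apply continuity_pt_filterlim in Hp. rewrite continuity_pt_locally in Hp.
  split; apply continuity_pt_filterlim, continuity_pt_locally; intros eps;
    destruct (HQ eps (cond_pos eps)) as [d [Hd H]];
    generalize (Hp (mkposreal d Hd)); apply filter_imp; intros u Hu; simpl in Hu;
    (assert (Hu' : (Cmod (RtoC (p u) - RtoC (p y)) < d)%R)
      by (rewrite <- RtoC_minus, Cmod_R; exact Hu));
    specialize (H _ Hu'); (eapply Rle_lt_trans; [|exact H]).
  - apply (re_le_Cmod (Q (RtoC (p u)) - Q (RtoC (p y)))).
  - apply (Rabs_Im_le_Cmod (Q (RtoC (p u)) - Q (RtoC (p y)))).
Qed.

Lemma uniform_radius (x : nat -> C) (n : nat) : (forall i, (i <= n)%nat -> disk (x i)) ->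
  exists r0, (0 < r0 < 1)%R /\ forall i, (i <= n)%nat -> (Cmod (x i) <= r0)%R.
Proof.
  induction n as [|n IH]; intros H.
  - exists (Rmax (1 / 2) (Cmod (x O))). split.
    + split; [eapply Rlt_le_trans; [|apply Rmax_l]; lra|].
      apply Rmax_lub_lt; [lra|]. apply H. lia.
    + intros i Hi. replace i with O by lia. apply Rmax_r.
  - destruct IH as [r0 [Hr0 Hx]]; [intros i Hi; apply H; lia|].
    exists (Rmax r0 (Cmod (x (S n)))). split.
    + split; [eapply Rlt_le_trans; [|apply Rmax_l]; lra|].
      apply Rmax_lub_lt; [lra|]. apply H. lia.
    + intros i Hi. destruct (Nat.eq_dec i (S n)) as [->|N]; [apply Rmax_r|].
      eapply Rle_trans; [apply Hx; lia|apply Rmax_l].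
Qed.

(* The factor [s ^ m] is Schwarz's lemma in disguise: on the circle of radius [r] it only
   costs the bound [r ^ -m], which tends to [1]. *)
Lemma pick (g : C -> C) (m n : nat) (x c : nat -> C) :
  (forall s, disk s -> holo g s) ->
  (forall s, disk s -> (Cmod (s ^ m * g s) <= 1)%R) ->
  (forall i, (i <= n)%nat -> disk (x i)) ->
  let q := sum_n (fun i => sum_n (fun j =>
    Cconj (c i) * ((1 - g (x i) * Cconj (g (x j))) / (1 - x i * Cconj (x j))) * c j) n) n in
  Im q = 0%R /\ (0 <= Re q)%R.
Proof.
  intros Hg Hb Hx.
  destruct (uniform_radius x n Hx) as [r0 [Hr0 Hxr]].
  (* The radius enters only through w = 1 / r^2, as B^2 = r^(-2 m) = w^m. Letting [r] tend to 1 is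
     then continuity of [Q] at 1. *)
  set (Q := fun w : C => sum_n (fun i => sum_n (fun j =>
    Cconj (c i) * ((w ^ m - g (x i) * Cconj (g (x j))) / (1 - x i * Cconj (x j) * w)) * c j) n) n).
  assert (HQ1 : Q 1 = sum_n (fun i => sum_n (fun j =>
    Cconj (c i) * ((1 - g (x i) * Cconj (g (x j))) / (1 - x i * Cconj (x j))) * c j) n) n).
  { apply sum_n_ext. intros i. apply sum_n_ext. intros j. now rewrite Cpow_1_l, Cmult_1_r. }
  intros q. unfold q. rewrite <- HQ1. clear q HQ1.
  assert (HQ : forall r, (r0 < r < 1)%R ->
    Im (Q (RtoC (/ (r * r)))) = 0%R /\ (0 <= Re (Q (RtoC (/ (r * r)))))%R).
  { intros r Hr. assert (Hp : (0 < / r ^ m)%R) by (apply Rinv_0_lt_compat, pow_lt; lra).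
    pose proof (pick_circle r (/ r ^ m) g n x c ltac:(lra) Hp) as P.
    assert (Ew : RtoC (/ (r * r)) ^ m = RtoC (/ r ^ m * / r ^ m)).
    { rewrite <- RtoC_pow. f_equal. rewrite <- Rinv_mult, <- Rpow_mult_distr. apply pow_inv. }
    unfold Q. rewrite Ew. apply P.
    - intros z Hz. apply Hg. unfold disk. lra.
    - intros z Hz. specialize (Hb z ltac:(unfold disk; lra)).
      rewrite Cmod_mult, Cmod_pow, Hz in Hb. pose proof (pow_lt r m ltac:(lra)).
      apply Rmult_le_reg_l with (r ^ m)%R; [assumption|]. rewrite Rinv_r; lra.
    - intros i Hi. specialize (Hxr i Hi). lra. }
  assert (CQ : ccont Q (RtoC (/ (1 * 1)))).
  { replace (RtoC (/ (1 * 1))) with (RtoC 1) by (f_equal; field).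
    apply (ccont_sum_n (fun i w => sum_n (fun j => Cconj (c i) *
      ((w ^ m - g (x i) * Cconj (g (x j))) / (1 - x i * Cconj (x j) * w)) * c j) n)).
    intros i Hi.
    apply (ccont_sum_n (fun j w => Cconj (c i) *
      ((w ^ m - g (x i) * Cconj (g (x j))) / (1 - x i * Cconj (x j) * w)) * c j)).
    intros j Hj. cbv beta.
    assert (A : 1 - x i * Cconj (x j) * 1 <> 0).
    { apply Cmod_lt_neq1. rewrite Cmult_1_r, Cmod_mult, Cmod_conj.
      pose proof (Hxr i Hi). pose proof (Hxr j Hj).
      pose proof (Cmod_ge_0 (x i)). pose proof (Cmod_ge_0 (x j)). nra. }
    apply (ccont_mult (fun w => Cconj (c i) *
      ((w ^ m - g (x i) * Cconj (g (x j))) / (1 - x i * Cconj (x j) * w))) (fun _ => c j));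
      [|apply ccont_const].
    apply (ccont_mult (fun _ => Cconj (c i))
      (fun w => (w ^ m - g (x i) * Cconj (g (x j))) / (1 - x i * Cconj (x j) * w)));
      [apply ccont_const|].
    unfold Cdiv. apply ccont_mult.
    - apply ccont_minus; [apply ccont_pow, ccont_id|apply ccont_const].
    - apply ccont_inv; [exact A|]. apply ccont_minus; [apply ccont_const|].
      apply ccont_mult; [apply ccont_const|apply ccont_id]. }
  assert (Cp : continuous (fun r => / (r * r))%R 1).
  { apply (ex_derive_continuous (fun r => / (r * r))%R). auto_derive. lra. }
  destruct (continuous_ccont_comp Q (fun r => / (r * r))%R 1 CQ Cp) as [C1 C2].
  replace (Q 1) with (Q (RtoC (/ (1 * 1)))) by (do 2 f_equal; field).
  assert (Lim : forall f : R -> R, continuous f 1 ->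
    (forall r, (r0 < r < 1)%R -> (0 <= f r)%R) -> (0 <= f 1)%R).
  { intros f Hf Hpos.
    assert (- f 1 <= 0)%R; [|lra].
    apply (le_of_le_left (fun r => - f r)%R 1 0 r0); [lra| |].
    - apply (continuous_opp (V := R_NormedModule) f). exact Hf.
    - intros r Hr. specialize (Hpos r Hr). lra. }
  split.
  - apply Rle_antisym.
    + assert (0 <= - Im (Q (RtoC (/ (1 * 1)))))%R; [|lra].
      apply (Lim (fun r => - Im (Q (RtoC (/ (r * r)))))%R).
      * apply (continuous_opp (V := R_NormedModule) _ _ C2).
      * intros r Hr. rewrite (proj1 (HQ r Hr)). lra.
    + apply (Lim (fun r => Im (Q (RtoC (/ (r * r)))))); [exact C2|].
      intros r Hr. rewrite (proj1 (HQ r Hr)). lra.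
  - apply (Lim (fun r => Re (Q (RtoC (/ (r * r)))))); [exact C1|].
    intros r Hr. apply (HQ r Hr).
Qed.

(** * The interpolation problem *)

Lemma circ_pow (a t : R) (d : nat) : circ a t ^ d = circ (a ^ d) (INR d * t).
Proof.
  induction d as [|d IH].
  - simpl. unfold circ. rewrite Rmult_0_l, cos_0, sin_0. unfold RtoC. f_equal; ring.
  - rewrite Cpow_S, IH, S_INR.
    replace ((INR d + 1) * t)%R with (t + INR d * t)%R by ring.
    unfold circ, Cmult; simpl. rewrite cos_plus, sin_plus. f_equal; ring.
Qed.

Lemma polar (s : C) : exists t, s = circ (Cmod s) t.
Proof.
  destruct (Ceq_dec s 0) as [->|N].
  { exists 0%R. rewrite Cmod_0. unfold circ, RtoC. f_equal; ring. }
  apply Cmod_pos in N. pose proof (Cmod2_alt s) as E.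
  destruct s as [x y]. unfold Re, Im in E; simpl fst in E; simpl snd in E.
  set (r := Cmod (x, y)) in *.
  assert (Hx : (-1 <= x / r <= 1)%R).
  { assert (x * x <= r * r)%R by nra.
    assert (- r <= x <= r)%R by nra.
    split; apply Rmult_le_reg_r with r; try lra; unfold Rdiv;
      rewrite Rmult_assoc, Rinv_l; lra. }
  assert (Hs : (1 - Rsqr (x / r) = Rsqr (y / r))%R).
  { unfold Rsqr. replace (1 - x / r * (x / r))%R with ((r ^ 2 - x ^ 2) / (r * r))%R by (field; lra).
    rewrite E. field. lra. }
  destruct (Rle_dec 0 y) as [Hy|Hy].
  - exists (acos (x / r)). unfold circ. rewrite cos_acos, sin_acos, Hs by exact Hx.
    rewrite sqrt_Rsqr_abs, Rabs_pos_eq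
      by (apply Rmult_le_pos; [lra|apply Rlt_le, Rinv_0_lt_compat; lra]).
    f_equal; field; lra.
  - exists (- acos (x / r))%R. unfold circ. rewrite cos_neg, sin_neg, cos_acos, sin_acos, Hs
      by exact Hx.
    rewrite sqrt_Rsqr_abs, Rabs_left.
    + f_equal; field; lra.
    + apply Rmult_lt_reg_r with r; [lra|]. unfold Rdiv. rewrite Rmult_assoc, Rinv_l; lra.
Qed.

(** Surjectivity of the power map on the disk carries the bound of [f] over to [g], which is known
    only through its values at d-th powers. *)
Lemma disk_root (s : C) (d : nat) : (0 < d)%nat -> disk s -> exists z, disk z /\ z ^ d = s.
Proof.
  intros Hd Hs. unfold disk in *.
  assert (R : exists z, z ^ d = s).
  { destruct (Ceq_dec s 0) as [->|N].
    - exists 0. destruct d; [lia|]. simpl. ring.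
    - apply Cmod_pos in N. destruct (polar s) as [t Ht].
      assert (Hd' : (0 < INR d)%R) by now apply lt_0_INR.
      exists (circ (Rpower (Cmod s) (/ INR d)) (t / INR d)).
      rewrite circ_pow. rewrite <- (Rpower_pow d) by apply exp_pos.
      rewrite Rpower_mult, Rinv_l, Rpower_1 by lra.
      replace (INR d * (t / INR d))%R with t by (field; lra). now rewrite <- Ht. }
  destruct R as [z Hz]. exists z. split; [|exact Hz].
  apply Rnot_le_lt. intros L. rewrite <- Hz, Cmod_pow in Hs.
  pose proof (pow_R1_Rle (Cmod z) d L). lra.
Qed.

Lemma mobius_den (l w : C) : disk l -> (Cmod w <= 1)%R -> 1 - Cconj l * w <> 0.
Proof.
  intros Hl Hw. apply Cmod_lt_neq1. rewrite Cmod_mult, Cmod_conj. unfold disk in Hl.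
  pose proof (Cmod_ge_0 l). pose proof (Cmod_ge_0 w). nra.
Qed.

Lemma mobius_bound (l w : C) : disk l -> (Cmod w <= 1)%R -> (Cmod (mobius l w) <= 1)%R.
Proof.
  intros Hl Hw. pose proof (mobius_den l w Hl Hw) as Hn. unfold mobius.
  rewrite Cmod_div by exact Hn. apply Cmod_pos in Hn.
  apply Rmult_le_reg_r with (Cmod (1 - Cconj l * w)); [exact Hn|].
  unfold Rdiv. rewrite Rmult_assoc, Rinv_l, Rmult_1_r, Rmult_1_l by lra.
  assert (E : ((Cmod (1 - Cconj l * w)) ^ 2 - (Cmod (w - l)) ^ 2 =
    (1 - Cmod l ^ 2) * (1 - Cmod w ^ 2))%R).
  { rewrite !Cmod2_alt. destruct l as [a b]; destruct w as [x y].
    unfold Re, Im; simpl. ring. }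
  unfold disk in Hl. pose proof (Cmod_ge_0 l). pose proof (Cmod_ge_0 w).
  pose proof (Cmod_ge_0 (w - l)).
  assert (0 <= (1 - Cmod l ^ 2) * (1 - Cmod w ^ 2))%R by (apply Rmult_le_pos; nra).
  apply Rsqr_incr_0; [unfold Rsqr; lra|lra|lra].
Qed.

(* The two-point Pick matrix at [0, z] would have a zero diagonal entry, forcing its
   off-diagonal entry [1 - f 0 * conj (f z)] to vanish. *)
Lemma interior_value_at_0 (f : C -> C) (z : C) :
  (forall s, disk s -> holo f s) -> (forall s, disk s -> (Cmod (f s) <= 1)%R) ->
  disk z -> disk (f z) -> disk (f 0).
Proof.
  intros Hf Hb Hz Hw. apply Rnot_le_lt. intros L.
  assert (H0 : disk 0) by (unfold disk; rewrite Cmod_0; lra).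
  assert (E1 : Cmod (f 0) = 1%R) by (specialize (Hb 0 H0); lra).
  assert (E : f 0 * Cconj (f 0) = 1) by (rewrite <- Cmod2_conj, E1; f_equal; ring).
  set (o := 1 - f 0 * Cconj (f z)).
  assert (Ho : o <> 0).
  { apply Cmod_lt_neq1. rewrite Cmod_mult, Cmod_conj, E1. unfold disk in Hw. lra. }
  set (p := (1 - f z * Cconj (f z)) / (1 - z * Cconj z)).
  assert (Po : (0 < Cmod o ^ 2)%R) by (apply pow_lt, Cmod_pos, Ho).
  (* On the vector [(- T * o, 1)] the form is [p - 2 * T * Cmod o ^ 2], and this [T] makes its real
     part negative. *)
  set (T := ((Rabs (Re p) + 1) / Cmod o ^ 2)%R).
  (* Exponent [0] gives the classical Pick condition; the [1] is the last index, so there are two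
     nodes. *)
  destruct (pick f 0 1 (fun i => match i with O => 0 | _ => z end)
    (fun i => match i with O => - (T * o) | _ => 1 end) Hf) as [_ P].
  - intros s Hs. rewrite Cmod_mult. simpl. rewrite Cmod_1, Rmult_1_l. now apply Hb.
  - intros [|i] _; assumption.
  - match type of P with (0 <= Re ?q)%R =>
      replace q with (RtoC (- 2 * (Rabs (Re p) + 1)) + p) in P end.
    + destruct p as [p1 p2]. simpl in P. pose proof (Rle_abs p1). pose proof (Rabs_pos p1). lra.
    + rewrite sum_Sn, sum_O, !sum_Sn, !sum_O. change plus with Cplus. cbv beta iota.
      rewrite E. fold o p.
      assert (Eo : 1 - f z * Cconj (f 0) = Cconj o).
      { unfold o. rewrite Cminus_conj, Cmult_conj, Cconj_conj.
        replace (Cconj 1) with (RtoC 1) by (unfold RtoC, Cconj; simpl; f_equal; ring). ring. }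
      assert (C0 : Cconj 0 = 0) by (unfold RtoC, Cconj; simpl; f_equal; ring).
      assert (C1 : Cconj 1 = 1) by (unfold RtoC, Cconj; simpl; f_equal; ring).
      assert (CT : Cconj T = T) by (unfold RtoC, Cconj; simpl; f_equal; ring).
      rewrite Eo, Copp_conj, Cmult_conj, C0, C1, CT.
      assert (ET : RtoC (Rabs (Re p) + 1) = T * (o * Cconj o)).
      { rewrite <- Cmod2_conj, <- RtoC_mult. f_equal. unfold T. field.
        apply Rgt_not_eq, Cmod_pos, Ho. }
      rewrite RtoC_mult, ET.
      replace (1 - 0 * 0) with (RtoC 1) by ring. replace (1 - 0 * Cconj z) with (RtoC 1) by ring.
      replace (1 - z * 0) with (RtoC 1) by ring.
      replace (RtoC (- 2)) with (- (1 + 1)) by (unfold RtoC, Cplus, Copp; simpl; f_equal; ring).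
      match goal with |- @eq _ ?a ?b => change (@eq C a b) end. field.
Qed.

(* Finite families are indexed from 1, as [ns 1], ..., [ns p]; the entry of a
   Coquelicot matrix in position (i, j) is counted from 0. *)
Theorem corollary4p2
  (K K1 : Ensemble nat) (d p N0 : nat) (ns : nat -> nat)
  (n : nat) (z w : nat -> C)
  (K_infinite : ~ Finite_sets.Finite nat K)
  (K_proper : Strict_Included nat K pos_nat)
  (K_algebra : is_algebra (HinfK K))
  (d_pos : (0 < d)%nat)
  (p_pos : (1 <= p)%nat)
  (ns_pos : forall i : nat, (1 <= i <= p)%nat -> (0 < ns i)%nat)
  (ns_increasing : forall i j : nat,
     (1 <= i)%nat -> (i < j)%nat -> (j <= p)%nat -> (ns i < ns j)%nat)
  (N0_pos : (0 < N0)%nat)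
  (N0_large : (ns p < N0)%nat)
  (K_compl : forall m : nat,
     In nat (Setminus nat pos_nat K) m <->
       (exists i : nat, (1 <= i <= p)%nat /\ m = (ns i * d)%nat) \/
       m = (N0 * d)%nat \/
       (exists j : nat, (0 < j)%nat /\ m = ((N0 + j) * d)%nat))
  (K1_pos : Included nat K1 pos_nat)
  (K1_compl : forall m : nat,
     In nat (Setminus nat pos_nat K1) m <->
       (exists i : nat, (1 <= i <= p)%nat /\ m = ns i) \/
       m = N0 \/
       (exists j : nat, (0 < j)%nat /\ m = (N0 + j)%nat))
  (z_disk : forall i : nat, (1 <= i <= n)%nat -> disk (z i))
  (z_distinct : forall i j : nat,
     (1 <= i <= n)%nat -> (1 <= j <= n)%nat -> i <> j -> z i <> z j)
  (w_disk : forall i : nat, (1 <= i <= n)%nat -> disk (w i)) :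
  is_least (Setminus nat pos_nat K1) (ns 1%nat) /\
  ((exists f : C -> C,
      HinfK K f /\
      (forall i : nat, (1 <= i <= n)%nat -> f (z i) = w i) /\
      Rbar_le (Hinf_norm f) (Rbar.Finite 1)) ->
   exists lambda : C,
     disk lambda /\
     positive_semidefinite
       (mk_matrix n n (fun i j : nat =>
          (z (S i) ^ (ns 1%nat * d) * Cconj (z (S j) ^ (ns 1%nat * d))
           - mobius lambda (w (S i)) * Cconj (mobius lambda (w (S j))))
          / (1 - z (S i) ^ d * Cconj (z (S j) ^ d))))).
Proof.
  assert (ns_le : forall i, (1 <= i <= p)%nat -> (ns 1 <= ns i)%nat).
  { intros i Hi. destruct (Nat.eq_dec i 1) as [->|N]; [lia|].
    apply Nat.lt_le_incl, ns_increasing; lia. }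
  assert (ns_N0 : (ns 1 < N0)%nat) by (specialize (ns_le p ltac:(lia)); lia).
  split.
  { split.
    - apply K1_compl. left. exists 1%nat. split; [lia|reflexivity].
    - intros k Hk. apply K1_compl in Hk.
      destruct Hk as [[i [Hi ->]]|[->|[j [Hj ->]]]]; [now apply ns_le|lia|lia]. }
  intros [f [[[f_an _] f_K] [f_z f_norm]]].
  assert (Hf : forall s, disk s -> holo f s) by (intros s Hs; now apply ex_derive_holo, f_an).
  assert (Hb : forall s, disk s -> (Cmod (f s) <= 1)%R).
  { intros s Hs. unfold Hinf_norm in f_norm.
    destruct (Lub_Rbar_correct (fun r : R => exists z : C, disk z /\ r = Cmod (f z))) as [U _].
    apply (Rbar_le_trans (Rbar.Finite (Cmod (f s))) _ (Rbar.Finite 1)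
      (U (Cmod (f s)) (ex_intro _ s (conj Hs eq_refl))) f_norm). }
  (* Without nodes [f] may be a constant of modulus 1, so [f 0] cannot serve as lambda; the form
     then reduces to its single default term 0, and 0 is a valid choice. With a node, [w 1] forces
     [f 0] into the open disk. *)
  destruct n as [|n'].
  { exists 0. split; [unfold disk; rewrite Cmod_0; lra|].
    intros v q. unfold q. rewrite !sum_O. simpl.
    split; ring_simplify; lra. }
  assert (H0 : disk (f 0)).
  { apply (interior_value_at_0 f (z 1%nat) Hf Hb); [apply z_disk; lia|].
    rewrite f_z by lia. apply w_disk. lia. }
  set (m := ns 1%nat) in *.
  assert (m_pos : (0 < m)%nat) by (apply ns_pos; lia).
  destruct (sparse_taylor f d m 1 d_pos m_pos Hf Hb) as [g [h [Hg [Hh [Efg Egh]]]]].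
  (* A positive exponent outside [K] has the form [q * d] with [m <= q], which contradicts both
     alternatives of [Hdk]. *)
  { intros k Hk Hdk. apply f_K. apply NNPP. intros NK.
    assert (Sk : In nat (Setminus nat pos_nat K) k) by (split; [exact Hk|exact NK]).
    apply K_compl in Sk.
    assert (Q : exists q, (m <= q)%nat /\ k = (q * d)%nat).
    { destruct Sk as [[i [Hi ->]]|[->|[j [Hj ->]]]].
      - exists (ns i). split; [now apply ns_le|reflexivity].
      - exists N0. split; [lia|reflexivity].
      - exists (N0 + j)%nat. split; [lia|reflexivity]. }
    destruct Q as [q [Hq ->]]. destruct Hdk as [Hdk|Hdk]; [apply Hdk; now exists q|nia]. }
  assert (Hgb : forall s, disk s -> (Cmod (g s) <= 1)%R).
  { intros s Hs. destruct (disk_root s d d_pos Hs) as [y [Hy <-]].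
    rewrite <- Efg by exact Hy. now apply Hb. }
  set (l := f 0) in *.
  set (G := fun s => h s / (1 - Cconj l * g s)).
  assert (EG : forall s, disk s -> s ^ m * G s = mobius l (g s)).
  { intros s Hs. pose proof (mobius_den l (g s) H0 (Hgb s Hs)) as Hn.
    assert (E : s ^ m * h s = g s - l) by (rewrite (Egh s Hs); ring).
    unfold G, mobius. unfold Cdiv. rewrite Cmult_assoc, E. reflexivity. }
  assert (Hz : forall i, (i <= n')%nat -> disk (z (S i)) /\ disk (z (S i) ^ d)).
  { intros i Hi. assert (D : disk (z (S i))) by (apply z_disk; lia). split; [exact D|].
    unfold disk in *. rewrite Cmod_pow. pose proof (Cmod_ge_0 (z (S i))).
    apply pow_lt_1_compat; [lra|exact d_pos]. }
  exists l. split; [exact H0|]. intros v.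
  (* The diagonal conjugation is absorbed into the test vector: with x_i = z_i^d, the entry is x_i^m
     conj (x_j^m) times the Pick entry of [G], so [v i] is replaced by v_i conj (x_i^m). *)
  destruct (pick G m n' (fun i => z (S i) ^ d)
    (fun i => v i * Cconj ((z (S i) ^ d) ^ m))) as [P1 P2].
  { intros s Hs. unfold G, Cdiv. apply holo_mult; [now apply Hh|].
    apply holo_inv; [now apply mobius_den; [|apply Hgb]|].
    apply holo_minus; [apply holo_const|].
    apply holo_mult; [apply holo_const|now apply Hg]. }
  { intros s Hs. rewrite EG by exact Hs. apply mobius_bound; auto. }
  { intros i Hi. now apply Hz. }
  intros q. unfold q. simpl pred.
  match type of P1 with Im ?a = _ => match goal with |- Im ?b = _ /\ _ =>
    replace b with a; [now split|] end end.
  apply sum_n_ext_loc. intros i Hi. apply sum_n_ext_loc. intros j Hj.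
  rewrite coeff_mat_bij by lia.
  assert (Ew : forall i, (i <= n')%nat -> mobius l (w (S i)) =
    (z (S i) ^ d) ^ m * G (z (S i) ^ d)).
  { intros k Hk. rewrite EG by now apply Hz. rewrite <- Efg by now apply Hz.
    rewrite f_z by lia. reflexivity. }
  rewrite !Ew by assumption. rewrite (Nat.mul_comm m d), !Cpow_mult_r.
  rewrite !Cmult_conj, Cconj_conj. unfold Cdiv. cring.
Qed.
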